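(* Let $\overline{M}$ be a smooth manifold with boundary $\partial M$ and interior $M$, and let $\nabla$ be an affine connection on $M$ which is projectively compact of some order $\alpha$ with $0<\alpha\leq 2$. Suppose that one has a geodesic path (for the projective structure on $\overline{M}$ extending the projective class of $\nabla$) which reaches $\partial M$ in a point $x_0$ with tangent transversal to $\partial M$. Then a part of this path can be parameterized as a geodesic for $\nabla$ in the form $c:[0,\infty)\to\overline{M}$ in such a way that $c([0,\infty))\subset M$ and $\lim_{t\to\infty}c(t)=x_0$.
   Context: All affine connections (linear connections on the tangent bundle) are torsion free; smooth means $C^\infty$. For a one-form $\Upsilon$, write $\hat\nabla=\nabla+\Upsilon$ for the connection $\hat\nabla_\xi\eta=\nabla_\xi\eta+\Upsilon(\xi)\eta+\Upsilon(\eta)\xi$. Connections so related are projectively equivalent (equivalently, they have the same geodesics up to parametrization); a projective structure is a projective equivalence class, and its geodesic paths are the unparametrized geodesics of the connections in the class. A local defining function for $\partial M$ is a smooth function $\rho:U\to\mathbb{R}_{\ge 0}$ on an open subset $U\subset\overline{M}$ with $\rho^{-1}(\{0\})=U\cap\partial M$ and $d\rho$ nowhere vanishing on $U\cap\partial M$. An affine connection $\nabla$ on $M$ is projectively compact of order $\alpha>0$ if every $x\in\partial M$ has a neighborhood $U$ in $\overline{M}$ with a defining function $\rho:U\to\mathbb{R}$ such that the connection $\hat\nabla=\nabla+\frac{d\rho}{\alpha\rho}$ on $U\cap M$ extends smoothly to all of $U$. In this case the projective class of $\nabla$ extends uniquely to a projective structure on $\overline{M}$ (locally near the boundary represented by the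 extended connections $\hat\nabla$). *)

(* Defs.v *)
From HB Require Import structures.
From mathcomp Require Import all_boot all_order all_algebra.
From mathcomp Require Import all_classical all_reals all_analysis.
Set Implicit Arguments.
Unset Strict Implicit.
Unset Printing Implicit Defensive.
Import Order.TTheory GRing.Theory Num.Theory.
Import numFieldNormedType.Exports.
Local Open Scope classical_set_scope.
Local Open Scope ring_scope.

Section calculus.
Context {R : realType}.

(* Meant for open U and finite-dimensional V: existence and continuity of all
   iterated directional derivatives up to order k is then the usual C^k. *)
Fixpoint Ck_on {V W : normedModType R} (k : nat) (U : set V) (f : V -> W) : Prop :=
  (forall x, U x -> {for x, continuous f}) /\
  if k is k'.+1 then
    forall v : V, (forall x, U x -> derivable f x v) /\
                  Ck_on k' U (fun x => derive f x v)
  else True.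

(* Smoothness on an arbitrary subset A (not necessarily open): local existence
   of smooth extensions to open sets of the ambient space. *)
Definition smooth_on {V W : normedModType R} (A : set V) (f : V -> W) : Prop :=
  forall x, A x -> exists (U : set V) (g : V -> W),
    [/\ open U, U x, (forall k, Ck_on k U g) &
        (forall y, (A `&` U) y -> f y = g y)].

(* Directional derivative using only the values of f on A. On a relatively open
   subset of a half-space, or on a nondegenerate interval, it is one-sided where
   necessary and agrees with the derivative of any smooth extension of f. *)
Definition derive_within {V W : normedModType R} (A : set V) (f : V -> W)
    (x v : V) : W :=
  lim ((fun h : R => h^-1 *: (f (h *: v + x) - f x))
         @ within [set h : R | A (h *: v + x)] 0^').

Definition half_space (n : nat) : set 'rV[R]_n.+1 := [set x | 0 <= x 0 0].

Definition basis_vec (n : nat) (i : 'I_n.+1) : 'rV[R]_n.+1 := delta_mx 0 i.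

Definition nondegenerate_interval (J : set R) : Prop :=
  is_interval J /\ exists s t, [/\ J s, J t & s < t].

End calculus.

(* A smooth manifold with boundary of dimension n.+1, given by an atlas
   (coord a, with inverse point a) valued in the half-space. In dimension 0 the
   boundary is empty, so nothing is lost by taking the dimension positive. *)
Record manifold_with_boundary (R : realType) (n : nat) := Manifold {
  carrier :> topologicalType;
  carrier_hausdorff : hausdorff_space carrier;
  carrier_second_countable : @second_countable carrier;
  chart : Type;
  dom : chart -> set carrier;
  coord : chart -> carrier -> 'rV[R]_n.+1;
  point : chart -> 'rV[R]_n.+1 -> carrier;
  dom_open : forall a, open (dom a);
  dom_cover : forall p, exists a, dom a p;
  coord_image_open : forall a, exists2 O : set 'rV[R]_n.+1,
    open O & coord a @` dom a = O `&` @half_space R n;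
  coordK : forall a p, dom a p -> point a (coord a p) = p;
  coord_continuous : forall a, {within dom a, continuous (coord a)};
  point_continuous : forall a,
    {within coord a @` dom a, continuous (point a)};
  transition_smooth : forall a b,
    smooth_on (coord a @` (dom a `&` dom b)) (coord b \o point a)
}.

Section manifolds.
Context {R : realType} {n : nat} (M : manifold_with_boundary R n).

Definition bdry : set M :=
  [set p | exists2 a : chart M, dom a p & coord a p 0 0 = 0].

Definition inner : set M := ~` bdry.

Definition coord_image (a : chart M) (U : set M) : set 'rV[R]_n.+1 :=
  coord a @` (dom a `&` U).

Definition transition (a b : chart M) : 'rV[R]_n.+1 -> 'rV[R]_n.+1 :=
  coord b \o point a.

(* First and second derivatives of the transition map from a to b. *)
Definition dtransition (a b : chart M) (x v : 'rV[R]_n.+1) : 'rV[R]_n.+1 :=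
  derive_within (coord_image a (dom b)) (transition a b) x v.

Definition d2transition (a b : chart M) (x v w : 'rV[R]_n.+1) : 'rV[R]_n.+1 :=
  derive_within (coord_image a (dom b)) (fun y => dtransition a b y w) x v.

Definition smooth_fun (U : set M) (f : M -> R) : Prop :=
  forall a, smooth_on (V := 'rV[R]_n.+1) (W := R^o)
              (coord_image a U) (f \o point a).

Definition covector_field : Type := chart M -> 'rV[R]_n.+1 -> 'rV[R]_n.+1.

Definition pairing (u v : 'rV[R]_n.+1) : R := \sum_i u 0 i * v 0 i.

(* A one-form on an open set U, through its components in the charts; values
   outside the coordinate images of U are irrelevant. *)
Definition one_form (U : set M) (Y : covector_field) : Prop :=
  (forall a, smooth_on (coord_image a U) (Y a)) /\
  (forall a b p, (dom a `&` dom b `&` U) p -> forall v,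
     pairing (Y a (coord a p)) v =
     pairing (Y b (coord b p)) (dtransition a b (coord a p) v)).

Definition differential (U : set M) (f : M -> R) : covector_field :=
  fun a x => \row_i derive_within (V := 'rV[R]_n.+1) (W := R^o)
                      (coord_image a U) (f \o point a) x (basis_vec i).

(* G a x i j is the vector whose k-th component is the Christoffel symbol
   Gamma^k_ij of the chart a at the coordinate point x. *)
Definition christoffel : Type :=
  chart M -> 'rV[R]_n.+1 -> 'I_n.+1 -> 'I_n.+1 -> 'rV[R]_n.+1.

Definition christoffel_form (G : 'I_n.+1 -> 'I_n.+1 -> 'rV[R]_n.+1)
    (v w : 'rV[R]_n.+1) : 'rV[R]_n.+1 :=
  \sum_i \sum_j (v 0 i * w 0 j) *: G i j.

(* A torsion-free affine connection on an open set U. The last clause is the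
   transformation law
     d tau (Gamma_a(v, w)) = d^2 tau (v, w) + Gamma_b(d tau v, d tau w)
   for the transition map tau from the chart a to the chart b. *)
Definition affine_connection (U : set M) (G : christoffel) : Prop :=
  [/\ (forall a i j, smooth_on (coord_image a U) (fun x => G a x i j)),
      (forall a p, (dom a `&` U) p -> forall i j,
         G a (coord a p) i j = G a (coord a p) j i) &
      (forall a b p, (dom a `&` dom b `&` U) p -> forall v w,
         let x := coord a p in
         dtransition a b x (christoffel_form (G a x) v w) =
         d2transition a b x v w +
         christoffel_form (G b (coord b p))
           (dtransition a b x v) (dtransition a b x w))].

Definition eq_connection_on (U : set M) (G G' : christoffel) : Prop :=
  forall a p, (dom a `&` U) p ->
    forall i j, G a (coord a p) i j = G' a (coord a p) i j.

(* nabla + Upsilon *)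
Definition proj_change (G : christoffel) (Y : covector_field) : christoffel :=
  fun a x i j =>
    G a x i j + Y a x 0 i *: basis_vec j + Y a x 0 j *: basis_vec i.

Definition proj_equivalent (U : set M) (G G' : christoffel) : Prop :=
  exists2 Y, one_form U Y & eq_connection_on U G' (proj_change G Y).

Definition projective_class (U : set M) (G : christoffel) : set christoffel :=
  [set G' | affine_connection U G' /\ proj_equivalent U G G'].

(* On the whole manifold, boundary included. *)
Definition projective_structure (P : set christoffel) : Prop :=
  exists2 G, affine_connection setT G & P = projective_class setT G.

Definition extends_projective_class (G : christoffel) (P : set christoffel) :
    Prop :=
  forall G', P G' -> proj_equivalent inner G G'.

Definition local_defining_function (U : set M) (rho : M -> R) : Prop :=
  [/\ open U, smooth_fun U rho, (forall p, U p -> 0 <= rho p),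
      (forall p, U p -> (rho p = 0 <-> bdry p)) &
      (forall a p, (dom a `&` U `&` bdry) p ->
         differential U rho a (coord a p) != 0)].

Definition projectively_compact (alpha : R) (G : christoffel) : Prop :=
  0 < alpha /\
  forall x, bdry x -> exists (U : set M) (rho : M -> R) (Ghat : christoffel),
    [/\ U x, local_defining_function U rho, affine_connection U Ghat &
        eq_connection_on (U `&` inner) Ghat
          (proj_change G (fun a y =>
             (alpha * rho (point a y))^-1 *: differential U rho a y))].

(* Curves are total functions on R, considered on a nondegenerate interval J. *)
Definition curve_in (a : chart M) (c : R -> M) : R^o -> 'rV[R]_n.+1 :=
  coord a \o c.

Definition velocity (J : set R) (a : chart M) (c : R -> M) (s : R) :
    'rV[R]_n.+1 :=
  derive_within (V := R^o) J (curve_in a c) s 1.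

Definition acceleration (J : set R) (a : chart M) (c : R -> M) (s : R) :
    'rV[R]_n.+1 :=
  derive_within (V := R^o) J (velocity J a c) s 1.

Definition smooth_curve (J : set R) (c : R -> M) : Prop :=
  {within J, continuous c} /\
  forall a, smooth_on (V := R^o) (J `&` c @^-1` dom a) (curve_in a c).

Definition geodesic (G : christoffel) (J : set R) (c : R -> M) : Prop :=
  [/\ nondegenerate_interval J, smooth_curve J c &
      forall a s, J s -> dom a (c s) ->
        acceleration J a c s +
        christoffel_form (G a (curve_in a c s))
          (velocity J a c s) (velocity J a c s) = 0].

(* sigma is a regular change of parameter from J' into J, and c' is the
   resulting parametrization of the part c (sigma J') of the path c. *)
Definition reparametrizes_part (J : set R) (c : R -> M) (J' : set R)
    (c' : R -> M) (sigma : R -> R) : Prop :=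
  smooth_on (V := R^o) (W := R^o) J' sigma /\
  forall t, J' t ->
    [/\ J (sigma t), derive_within (V := R^o) (W := R^o) J' sigma t 1 != 0 &
        c' t = c (sigma t)].

(* c is some regular parametrization of a geodesic d of a connection in P. *)
Definition geodesic_path (P : set christoffel) (J : set R) (c : R -> M) :
    Prop :=
  nondegenerate_interval J /\
  exists G J' d sigma,
    [/\ P G, geodesic G J' d & reparametrizes_part J' d J c sigma].

(* The tangent space of the boundary is the kernel of the 0-th coordinate in a
   boundary chart. *)
Definition reaches_bdry_transversally (J : set R) (c : R -> M) (s0 : R)
    (x0 : M) : Prop :=
  [/\ J s0, c s0 = x0 &
      exists a : chart M,
        [/\ dom a x0, coord a x0 0 0 = 0 & velocity J a c s0 0 0 != 0]].

End manifolds.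

Arguments bdry {R n} M.
Arguments inner {R n} M.

(* Main.v *)
(* Let d be a geodesic, up to the boundary, of a connection G = nabla + Y in the
   projective class. Then c = d o tau is a geodesic of nabla iff
   tau'' = 2 Y(d'(tau)) tau'^2, that is, iff tau' is a multiple of
   exp (2 int Y(d')). Near x0 projective compactness gives
   Y = Z + drho / (alpha rho), where Z, read off from G - Ghat, is smooth up to
   the boundary. As d is transversal to the boundary, rho vanishes to exactly
   first order along d, so exp (2 int Y(d')) is comparable to r^(2 / alpha) with
   r the distance to the boundary parameter. Since 2 / alpha >= 1, the equation
   r' = - O(r) keeps r positive for all times while r tends to 0. The form of the
   equation for tau does not depend on the chart because Y is a one-form. *)
Require Import Defs.
From HB Require Import structures.
From mathcomp Require Import all_boot all_order all_algebra.
From mathcomp Require Import all_classical all_reals all_analysis.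
From mathcomp Require Import ring lra.
Set Implicit Arguments.
Unset Strict Implicit.
Unset Printing Implicit Defensive.
Import Order.TTheory GRing.Theory Num.Theory.
Import numFieldNormedType.Exports.
(* [vector.coord] and [matrix_normedtype.coord_continuous] shadow fields of
   [manifold_with_boundary]. *)
Import Defs.
Local Open Scope classical_set_scope.
Local Open Scope ring_scope.

(** * Maps of class C^k *)

(** The obstacle is one-sidedness: [s0] may be an endpoint of [J], and its image an endpoint of the
    domain of [d]. All data along the path are therefore replaced by smooth extensions to a full
    neighborhood of the boundary parameter, which carry geometric meaning only on the side of [J].
    The distance [r] is measured in the parameter of the given path, [s = s0 + eps * r]. Writing
    [tau = theta o g], the second order equation for [tau] reduces to the autonomous equation
    [g' = - F(g)], where [F theta'] is a constant multiple of the exponential. This is solved by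
    quadrature, as the inverse of an antiderivative of [- 1 / F], and smoothness of [g] is then
    bootstrapped from the equation itself. [Z] is read off from diagonal Christoffel symbols: adding
    a one-form raises the [i]-th component of [Gamma_ii] by twice the [i]-th component of the form.
    The geodesic equation of [c] is compared with that of [d] in one and the same chart, so only the
    number [Y(d')] is carried between charts. *)

Lemma near_eq_continuous_at {T S : topologicalType} (f g : T -> S) x :
  {near x, f =1 g} -> {for x, continuous f} -> {for x, continuous g}.
Proof.
move=> fg; rewrite /prop_for /continuous_at -(nbhs_singleton fg).
by apply: cvg_trans; exact: near_eq_cvg.
Qed.

Section Ck_general.
Context {R : realType} {V W : normedModType R}.
Implicit Types (U : set V) (f g : V -> W) (k : nat).

Lemma Ck_on_continuous k U f x :
  Ck_on k U f -> U x -> {for x, continuous f}.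
Proof. by case: k => [|k] [+ _]; apply. Qed.

Lemma Ck_on_derivable k U f x {v} : Ck_on k.+1 U f -> U x -> derivable f x v.
Proof. by case=> _ /(_ v)[+ _]; apply. Qed.

Lemma Ck_on_derive k U f v : Ck_on k.+1 U f -> Ck_on k U (fun x => 'D_v f x).
Proof. by case=> _ /(_ v)[]. Qed.

Lemma Ck_onW k U f : Ck_on k.+1 U f -> Ck_on k U f.
Proof.
elim: k f => [|k IH] f [fc fd]; first by split.
by split=> // v; have [? /IH] := fd v.
Qed.

Lemma Ck_on_subset k U U' f : U' `<=` U -> Ck_on k U f -> Ck_on k U' f.
Proof.
move=> U'U; elim: k f => [|k IH] f [fc fd]; first by split=> // x /U'U/fc.
split=> [x /U'U/fc//|v]; have [fv /IH ?] := fd v.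
by split=> // x /U'U/fv.
Qed.

Lemma Ck_on_local k U f :
  (forall x, U x -> exists2 U', U' x & Ck_on k U' f) -> Ck_on k U f.
Proof.
elim: k f => [|k IH] f loc.
  by split=> // x /loc[U' U'x [+ _]]; apply.
split=> [x /loc[U' U'x [+ _]]|v]; first exact.
split=> [x /loc[U' U'x fC]|]; first exact: Ck_on_derivable fC U'x.
by apply: IH => x /loc[U' U'x fC]; exists U' => //; exact: Ck_on_derive.
Qed.

Lemma eq_Ck_on k U f g : open U -> (forall x, U x -> f x = g x) ->
  Ck_on k U f -> Ck_on k U g.
Proof.
move=> oU.
have near_eq f' g' x : (forall y, U y -> f' y = g' y) -> U x -> {near x, f' =1 g'}.
  move=> fg Ux; have := open_nbhs_nbhs (conj oU Ux).
  by apply: filterS => y; exact: fg.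
have Cfg j f' g' : (forall y, U y -> f' y = g' y) -> Ck_on j U f' ->
    forall y, U y -> {for y, continuous g'}.
  move=> fg fC y Uy.
  exact: near_eq_continuous_at (near_eq _ _ _ fg Uy) (Ck_on_continuous fC Uy).
elim: k f g => [|k IH] f g fg fC.
  by split=> //; exact: Cfg fg fC.
split=> [|v]; first exact: Cfg fg fC.
have nfg x := near_eq f g x fg.
split=> [x Ux|].
  exact: near_eq_derivable (nfg _ Ux) (Ck_on_derivable fC Ux).
apply: IH (Ck_on_derive v fC) => x Ux.
exact: near_eq_derive (nfg _ Ux).
Qed.

Lemma Ck_on_cst k U (w : W) : open U -> Ck_on k U (fun=> w).
Proof.
move=> oU; elim: k w => [|k IH] w; first by split=> // x _; exact: cvg_cst.
split=> [x _|v]; first exact: cvg_cst.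
split=> [x _|]; first exact: derivable_cst.
by apply: eq_Ck_on (IH 0) => // x _; rewrite derive_cst.
Qed.

Lemma Ck_onD k U f g : open U -> Ck_on k U f -> Ck_on k U g ->
  Ck_on k U (fun x => f x + g x).
Proof.
move=> oU; elim: k f g => [|k IH] f g fC gC.
  split=> // x Ux; apply: continuousD;
    [exact: Ck_on_continuous fC Ux|exact: Ck_on_continuous gC Ux].
split=> [x Ux|v].
  by apply: continuousD;
    [exact: Ck_on_continuous fC Ux|exact: Ck_on_continuous gC Ux].
split=> [x Ux|].
  by apply: derivableD; [exact: Ck_on_derivable fC Ux|exact: Ck_on_derivable gC Ux].
apply: eq_Ck_on (IH _ _ (Ck_on_derive v fC) (Ck_on_derive v gC)) => // x Ux.
by rewrite deriveD//; [exact: Ck_on_derivable fC Ux|exact: Ck_on_derivable gC Ux].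
Qed.

Lemma Ck_on_sum k U (I : Type) (r : seq I) (f : I -> V -> W) : open U ->
  (forall i, Ck_on k U (f i)) -> Ck_on k U (fun x => \sum_(i <- r) f i x).
Proof.
move=> oU fC; elim: r => [|i r IH].
  apply: eq_Ck_on (Ck_on_cst k 0 oU) => // x _; by rewrite big_nil.
apply: eq_Ck_on (Ck_onD oU (fC i) IH) => // x _; by rewrite big_cons.
Qed.

Lemma smooth_on_interior k (A U : set V) f : smooth_on A f ->
  open U -> U `<=` A -> Ck_on k U f.
Proof.
move=> fA oU UA; apply: Ck_on_local => x Ux.
have [U' [g [oU' U'x gC fg]]] := fA x (UA _ Ux).
exists (U `&` U'); first by split.
apply: (@eq_Ck_on _ _ g); first exact: openI.
  by move=> y [Uy U'y]; rewrite fg//; split => //; exact: UA.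
exact: Ck_on_subset (gC k).
Qed.

End Ck_general.

Section Ck_scalar.
Context {R : realType} {V : normedModType R}.
Implicit Types (U : set V) (f g : V -> R^o) (k : nat).

Lemma Ck_onM k U f g : open U -> Ck_on k U f -> Ck_on k U g ->
  Ck_on k U (fun x => f x * g x : R^o).
Proof.
move=> oU; elim: k f g => [|k IH] f g fC gC.
  split=> // x Ux; apply: continuousM;
    [exact: Ck_on_continuous fC Ux|exact: Ck_on_continuous gC Ux].
split=> [x Ux|v].
  by apply: continuousM;
    [exact: Ck_on_continuous fC Ux|exact: Ck_on_continuous gC Ux].
split=> [x Ux|].
  by apply: derivableM; [exact: Ck_on_derivable fC Ux|exact: Ck_on_derivable gC Ux].
apply: eq_Ck_on (Ck_onD oU (IH _ _ (Ck_onW fC) (Ck_on_derive v gC))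
  (IH _ _ (Ck_onW gC) (Ck_on_derive v fC))) => // x Ux.
by rewrite deriveM//; [exact: Ck_on_derivable fC Ux|exact: Ck_on_derivable gC Ux].
Qed.

Lemma continuous_mxP m n (x : V) (f : V -> 'M[R]_(m, n)) :
  {for x, continuous f} <-> forall i j, {for x, continuous (fun y => f y i j : R^o)}.
Proof.
split=> [fc i j|fc].
  apply: (@continuous_comp _ _ _ f (fun M : 'M[R]_(m, n) => M i j)) => //.
  exact: matrix_normedtype.coord_continuous.
apply/cvgrPdist_lt => /= e e0; near=> y.
rewrite [ltLHS]/Num.Def.normr/= mx_normrE; apply: bigmax_lt => // i _.
rewrite !mxE/=; move: i; near: y; apply: filter_forall => i.
by have /cvgrPdist_lt/(_ _ e0) := fc i.1 i.2.
Unshelve. all: by end_near. Qed.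

Lemma Ck_on_mxP k m n U (f : V -> 'M[R]_(m, n)) : open U ->
  Ck_on k U f <-> forall i j, Ck_on k U (fun x => f x i j : R^o).
Proof.
move=> oU; elim: k f => [|k IH] f; (split=> [fC i j|fC]).
- by split=> // x /(Ck_on_continuous fC)/continuous_mxP.
- by split=> // x Ux; apply/continuous_mxP => i j; exact: Ck_on_continuous (fC i j) Ux.
- split=> [x /(Ck_on_continuous fC)/continuous_mxP//|v].
  split=> [x /(@Ck_on_derivable _ _ _ _ _ _ _ v fC)/derivable_mxP//|].
  have /IH/(_ i j) := Ck_on_derive v fC; apply: eq_Ck_on => // x Ux.
  by rewrite derive_mx ?mxE//; exact: Ck_on_derivable fC Ux.
- split=> [x Ux|v].
    by apply/continuous_mxP => i j; exact: Ck_on_continuous (fC i j) Ux.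
  have fd x : U x -> derivable f x v.
    by move=> Ux; apply/derivable_mxP => i j; exact: Ck_on_derivable (fC i j) Ux.
  split=> //; apply/IH => i j; have := Ck_on_derive v (fC i j).
  by apply: eq_Ck_on => // x Ux; rewrite derive_mx ?mxE//; exact: fd.
Qed.

End Ck_scalar.

(** * The chain rule for C^1 maps *)

Section chain_rule.
Context {R : realType}.

Lemma is_derive_line {V W : normedModType R} (f : V -> W) (q v : V) (h : R) :
  derivable f (h *: v + q) v ->
  is_derive (h : R^o) (1 : R^o) (fun h : R^o => f (h *: v + q)) ('D_v f (h *: v + q)).
Proof.
have E : (fun k : R => k^-1 *: (f ((k *: (1 : R^o) + h) *: v + q) - f (h *: v + q))) =
         (fun k : R => k^-1 *: (f (k *: v + (h *: v + q)) - f (h *: v + q))).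
  by apply/funext => k; rewrite [k *: v + _]addrA -scalerDl [k *: (1 : R^o)]mulr1.
by move=> fd; apply: DeriveDef; rewrite /derivable /derive /= E.
Qed.

Lemma MVT_line {V : normedModType R} (f : V -> R^o) (q v : V) (c : R) :
  (forall h : R, `|h| <= `|c| -> derivable f (h *: v + q) v) ->
  exists2 h : R, `|h| <= `|c| & f (c *: v + q) - f q = c * 'D_v f (h *: v + q).
Proof.
move=> fd.
have d1 (h : R) : `|h| <= `|c| -> is_derive (h : R^o) (1 : R^o)
    (fun h : R^o => f (h *: v + q)) ('D_v f (h *: v + q)).
  by move=> hc; apply: is_derive_line; exact: fd.
have cont (a b : R) : (forall x, x \in `[a, b] -> `|x| <= `|c|) ->
    {within `[a, b], continuous (fun h : R^o => f (h *: v + q))}.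
  move=> ab; apply: derivable_within_continuous => x /ab xc.
  by have [] := d1 _ xc.
have [c0|c0] := leP 0 c.
- have bd x : x \in `[0, c] -> `|x| <= `|c|.
    by rewrite in_itv/= => /andP[x0 xc]; rewrite !ger0_norm.
  have dd x : x \in `]0, c[ -> is_derive x 1 (fun h : R => f (h *: v + q) : R)
      ('D_v f (x *: v + q)).
    by move=> xc; apply: d1; apply: bd; exact: subset_itv_oo_cc xc.
  have [x xc] := MVT_segment c0 dd (cont _ _ bd).
  rewrite scale0r add0r subr0 mulrC => fE; exists x => //; exact: bd.
- have bd x : x \in `[c, 0] -> `|x| <= `|c|.
    by rewrite in_itv/= => /andP[x0 xc]; rewrite !ler0_norm ?lerN2// ltW.
  have dd x : x \in `]c, 0[ -> is_derive x 1 (fun h : R => f (h *: v + q) : R)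
      ('D_v f (x *: v + q)).
    by move=> xc; apply: d1; apply: bd; exact: subset_itv_oo_cc xc.
  have [x xc] := MVT_segment (ltW c0) dd (cont _ _ bd).
  rewrite scale0r add0r sub0r mulrN mulrC => /eqP; rewrite -eqr_oppLR opprB => /eqP fE.
  by exists x => //; exact: bd.
Qed.

Lemma ler_rV_norm m (x : 'rV[R]_m) (r : R) : 0 <= r ->
  (`|x| <= r) <-> forall i, `|x 0 i| <= r.
Proof.
move=> r0; rewrite [`|x|]/Num.Def.normr/= mx_normrE; split.
  by move=> xr i; apply: le_trans xr; exact: (le_bigmax _ (fun ij => `|x ij.1 ij.2|) (0, i)).
by move=> xr; apply: bigmax_le => // -[i j] _ /=; rewrite ord1.
Qed.

(** Walk from [p] to [v + p] along the coordinate axes and use the mean value theorem on each edge;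
    [T k] keeps the first [k] coordinates of [v]. In the sup norm the whole walk stays within [|v|]
    of [p]. *)
Lemma increment_rV n (f : 'rV[R]_n.+1 -> R^o) (p v : 'rV[R]_n.+1) :
  (forall q i, `|q - p| <= `|v| -> derivable f q (basis_vec i)) ->
  exists2 q : 'I_n.+1 -> 'rV[R]_n.+1, (forall i, `|q i - p| <= `|v|) &
    f (v + p) - f p = \sum_i v 0 i * 'D_(basis_vec i) f (q i).
Proof.
move=> fd.
pose T (k : nat) : 'rV[R]_n.+1 := \row_i (if (i < k)%N then v 0 i else 0).
have vi i : `|v 0 i| <= `|v| by have /ler_rV_norm := lexx `|v|; apply.
have TS (i : 'I_n.+1) : T i.+1 = v 0 i *: basis_vec i + T i.
  apply/rowP => j; rewrite !mxE eqxx/= ltnS.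
  by case: ltngtP => [ji|ji|/val_inj->]; rewrite ?eqxx ?mulr1 ?addr0//;
    (have -> : (j == i) = false by apply/eqP => ji'; rewrite ji' ltnn in ji);
    rewrite mulr0 ?add0r.
have near_p (i : 'I_n.+1) (h : R) : `|h| <= `|v 0 i| ->
    `|h *: basis_vec i + (T i + p) - p| <= `|v|.
  move=> hv; rewrite addrA addrK; apply/ler_rV_norm => // j; rewrite !mxE eqxx/=.
  have [->|ji] := eqVneq j i; first by rewrite ltnn mulr1 addr0 (le_trans hv).
  by rewrite mulr0 add0r; case: ifP => // _; rewrite normr0.
have [q qP] : exists q : 'I_n.+1 -> 'rV[R]_n.+1, forall i, `|q i - p| <= `|v| /\
    f (T i.+1 + p) - f (T i + p) = v 0 i * 'D_(basis_vec i) f (q i).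
  suff H (i : 'I_n.+1) : exists q, `|q - p| <= `|v| /\
      f (T i.+1 + p) - f (T i + p) = v 0 i * 'D_(basis_vec i) f q.
    by have /fin_all_exists[q] := H; exists q.
  have [h hv|h hv E] := @MVT_line _ f (T i + p) (basis_vec i) (v 0 i).
    by apply: fd; exact: near_p.
  by exists (h *: basis_vec i + (T i + p)); split; [exact: near_p|rewrite -E TS !addrA].
exists q => [i|]; first by have [] := qP i.
have -> : v = T n.+1 by apply/rowP => j; rewrite mxE ltn_ord.
have {2}-> : p = T 0%N + p.
  by rewrite -[LHS]add0r; congr (_ + _); apply/rowP => j; rewrite !mxE.
rewrite -(@telescope_sumr _ 0 n.+1 (fun k => f (T k + p)))// big_mkord.
by apply: eq_bigr => i _; have [_ ->] := qP i; rewrite mxE ltn_ord.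
Qed.

(** [Ck_on] only speaks of directional derivatives. Continuity of the partial derivatives, applied
    at the intermediate points of [increment_rV], upgrades them to a Frechet derivative, which the
    chain rule requires. *)
Lemma C1_differentiable n (U : set 'rV[R]_n.+1) (f : 'rV[R]_n.+1 -> R^o) p :
  open U -> U p -> Ck_on 1 U f ->
  differentiable f p /\ forall v, 'd f p v = \sum_i v 0 i * 'D_(basis_vec i) f p.
Proof.
move=> oU Up fC.
pose L (v : 'rV[R]_n.+1) : R^o := \sum_i v 0 i * 'D_(basis_vec i) f p.
have Llin : linear L.
  move=> a u v; rewrite /L scaler_sumr -big_split/=; apply: eq_bigr => i _.
  by rewrite !mxE mulrDl -mulrA.
pose Lm := GRing.isLinear.Build _ _ _ _ _ Llin.
pose LL : {linear 'rV[R]_n.+1 -> R^o} := HB.pack L Lm.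
have Lcont : continuous LL.
  move=> x; apply: (@Ck_on_continuous _ _ _ 0 setT) => //.
  apply: (@Ck_on_sum _ _ _ 0 setT) => [|i]; first exact: openT.
  split=> // y _; apply: continuousM; last exact: cst_continuous.
  exact: matrix_normedtype.coord_continuous.
have Lo : f \o shift p = cst (f p) + LL +o_ (0 : 'rV[R]_n.+1) id.
  apply/eqaddoP => e e0.
  (* The admissible error [e] is shared equally among the [n.+1] partial derivatives. *)
  pose m : R := n.+1%:R.
  have m0 : 0 < m by rewrite ltr0n.
  have : \forall q \near p, U q /\ forall i,
      `|'D_(basis_vec i) f q - 'D_(basis_vec i) f p| <= e / m.
    near=> q; split; first by near: q; exact: open_nbhs_nbhs.
    near: q; apply: filter_forall => i.
    have /(@Ck_on_continuous _ _ _ _ _ _ p)/(_ Up) := Ck_on_derive (basis_vec i) fC.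
    move/cvgrPdist_le/(_ (e / m)); rewrite divr_gt0// => /(_ isT).
    by apply: filterS => q; rewrite distrC.
  move=> /nbhs_normP[d /= d0 dP].
  have Hd : \forall v \near (0 : 'rV[R]_n.+1), `|v| < d by apply/nbhs_norm0P; exists d.
  near=> v.
  have vd : `|v| < d by near: v; exact: Hd.
  have inb q : `|q - p| <= `|v| -> U q /\ forall i,
      `|'D_(basis_vec i) f q - 'D_(basis_vec i) f p| <= e / m.
    by move=> qv; apply: dP; rewrite /= distrC (le_lt_trans qv).
  have [q i qv|q qP E] := @increment_rV n f p v.
    by have [Uq _] := inb _ qv; exact: Ck_on_derivable fC Uq.
  rewrite !fctE/= opprD addrA E /L -sumrB.
  rewrite (le_trans (ler_norm_sum _ _ _))//.
  apply: (@le_trans _ _ (\sum_(i < n.+1) (e / m * `|v|))).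
    apply: ler_sum => i _; rewrite -mulrBr normrM mulrC.
    apply: ler_pM => //; first by have [_] := inb _ (qP i).
    by have /ler_rV_norm := lexx `|v|; apply.
  by rewrite sumr_const card_ord -mulr_natr -/m mulrAC divfK// gt_eqF.
have dE : 'd f p = LL :> (_ -> _) by apply: diff_unique.
split=> [|v]; last by rewrite dE.
by apply/diff_locallyP; rewrite dE.
Unshelve. all: by end_near. Qed.

Lemma is_derive_comp_rV n (U : set 'rV[R]_n.+1) (f : 'rV[R]_n.+1 -> R^o)
    (x : R^o -> 'rV[R]_n.+1) (s : R^o) :
  open U -> U (x s) -> Ck_on 1 U f -> derivable x s 1 ->
  is_derive s 1 (f \o x) (\sum_i ('D_1 x s) 0 i * 'D_(basis_vec i) f (x s)).
Proof.
move=> oU Ux fC /derivable1_diffP xd.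
have [fd fE] := C1_differentiable oU Ux fC.
have fxd : differentiable (f \o x) s by exact: differentiable_comp.
apply: DeriveDef; first by apply/derivable1_diffP.
by rewrite deriveE// diff_comp//= fE -deriveE.
Qed.

End chain_rule.

Section derivatives_on_lines.
Context {R : realType}.

Lemma is_derive_comp_line {W : normedModType R} (f : R^o -> W) (t : R^o -> R^o) (s : R^o) :
  derivable t s 1 -> derivable f (t s) 1 ->
  is_derive s 1 (f \o t) ('D_1 t s *: 'D_1 f (t s)).
Proof.
move=> td fd.
have td' := (derivable1_diffP t s).1 td; have fd' := (derivable1_diffP f (t s)).1 fd.
have ftd := differentiable_comp td' fd'.
apply: DeriveDef; first exact/derivable1_diffP.
by rewrite (deriveE _ ftd) (diff_comp td' fd')/= -(deriveE _ td') (diff1E fd') derive1E.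
Qed.

Lemma is_derive_compR (f g : R -> R) (x df dg : R) :
  is_derive (g x) 1 f df -> is_derive x 1 g dg ->
  is_derive x 1 (f \o g) (df * dg).
Proof.
move=> [fd fE] [gd gE]; have [cd cE] := @is_derive_comp_line R^o f g x gd fd.
by apply: (DeriveDef cd); rewrite cE fE gE [LHS]mulrC.
Qed.

End derivatives_on_lines.

(** * Smooth functions and curves of one real variable *)

Section Ck_line.
Context {R : realType}.
Implicit Types (U T : set R^o) (f : R^o -> R^o) (k : nat).

Lemma deriveE1 f (x v : R^o) : derivable f x 1 -> 'D_v f x = v * 'D_1 f x.
Proof.
by move=> /derivable1_diffP fd; rewrite (deriveE _ fd) (diff1E fd) derive1E.
Qed.

(** On the line the derivative in direction [v] is [v] times the derivative in direction 1, so one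
    direction controls all those quantified in [Ck_on]. *)
Lemma Ck_onS1 k U f : open U -> (forall x, U x -> derivable f x 1) ->
  Ck_on k U (fun x => 'D_1 f x) -> Ck_on k.+1 U f.
Proof.
move=> oU fd fC; have fdf x : U x -> differentiable f x.
  by move=> /fd /derivable1_diffP.
split=> [x /fdf/differentiable_continuous//|v].
split=> [x /fdf/diff_derivable//|].
apply: eq_Ck_on (Ck_onM oU (Ck_on_cst k (v : R^o) oU) fC) => // x /fd xd.
by rewrite [RHS]deriveE1.
Qed.

Lemma Ck_on_comp1 k T U f (t : R^o -> R^o) : open T -> open U ->
  (forall s, T s -> U (t s)) -> Ck_on k T t -> Ck_on k U f ->
  Ck_on k T (f \o t).
Proof.
move=> oT oU TU; elim: k f => [|k IH] f tC fC.
  split=> // s Ts; apply: continuous_comp; first exact: Ck_on_continuous tC Ts.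
  by apply: Ck_on_continuous fC _; exact: TU.
have td s : T s -> differentiable t s.
  by move=> Ts; apply/derivable1_diffP; exact: Ck_on_derivable tC Ts.
have fd s : U s -> differentiable f s.
  by move=> Us; apply/derivable1_diffP; exact: Ck_on_derivable fC Us.
apply: Ck_onS1 => // [s Ts|].
  by apply/derivable1_diffP/differentiable_comp; [exact: td|apply: fd; exact: TU].
have := Ck_onM oT (Ck_on_derive (1 : R^o) tC) (IH _ (Ck_onW tC) (Ck_on_derive (1 : R^o) fC)).
apply: eq_Ck_on => // s Ts /=.
rewrite -[RHS]derive1E (@derive1_comp R t f s) ?derive1E 1?mulrC//.
- exact/derivable1_diffP/td.
- exact/derivable1_diffP/fd/TU.
Qed.

Lemma Ck_on_comp_rV k n T (U : set 'rV[R]_n.+1) (f : 'rV[R]_n.+1 -> R^o)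
    (x : R^o -> 'rV[R]_n.+1) : open T -> open U ->
  (forall s, T s -> U (x s)) -> Ck_on k T x -> Ck_on k U f ->
  Ck_on k T (f \o x).
Proof.
move=> oT oU TU; elim: k f => [|k IH] f xC fC.
  split=> // s Ts; apply: continuous_comp; first exact: Ck_on_continuous xC Ts.
  by apply: Ck_on_continuous fC _; exact: TU.
have fC1 : Ck_on 1 U f.
  by elim: (k) fC => // j IHj /Ck_onW.
have fxd s : T s -> is_derive s 1 (f \o x) (\sum_i ('D_1 x s) 0 i * 'D_(basis_vec i) f (x s)).
  move=> Ts; apply: is_derive_comp_rV fC1 _ => //; first exact: TU.
  exact: Ck_on_derivable xC Ts.
apply: Ck_onS1 => // [s /fxd[]//|].
have sC : Ck_on k T (fun s => \sum_i ('D_1 x s) 0 i * 'D_(basis_vec i) f (x s) : R^o).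
  apply: Ck_on_sum => // i; apply: Ck_onM => //.
    by have /(Ck_on_mxP k _ oT) := Ck_on_derive (1 : R^o) xC; apply.
  exact: IH (Ck_onW xC) (Ck_on_derive _ fC).
by apply: eq_Ck_on sC => // s /fxd[_ ->].
Qed.

Lemma Ck_on_comp_mx k m n T U (f : R^o -> 'M[R]_(m, n)) (t : R^o -> R^o) :
  open T -> open U -> (forall s, T s -> U (t s)) -> Ck_on k T t -> Ck_on k U f ->
  Ck_on k T (f \o t).
Proof.
move=> oT oU TU tC /(Ck_on_mxP k f oU) fC; apply/Ck_on_mxP => // i j.
exact: (Ck_on_comp1 oT oU TU tC (fC i j)).
Qed.

Lemma Ck_onV k U f : open U -> (forall x, U x -> f x != 0) -> Ck_on k U f ->
  Ck_on k U (fun x => (f x)^-1 : R^o).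
Proof.
move=> oU f0; elim: k => [|k IH] fC.
  by split=> // x Ux; apply: continuousV; [exact: f0|exact: Ck_on_continuous fC Ux].
have fd x : U x -> derivable f x 1 by move=> Ux; exact: Ck_on_derivable fC Ux.
apply: (Ck_onS1 oU) => [x Ux|]; first exact: derivableV (f0 _ Ux) (fd _ Ux).
have IV := IH (Ck_onW fC).
have := Ck_onM oU (Ck_onM oU (Ck_on_cst k (-1 : R^o) oU) (Ck_onM oU IV IV))
  (Ck_on_derive (1 : R^o) fC).
apply: eq_Ck_on => // x Ux; rewrite deriveV ?f0//; last exact: fd.
by rewrite mulN1r expr2 invfM.
Qed.

(** Bootstrap: if [f] is C^k then so is [f' = f y], hence [f] is C^(k+1). It serves to make the
    integrating factor [Psi] smooth from its equation, without differentiating [expR] and [ln]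
    repeatedly. *)
Lemma smooth_linear_ode U f y : open U ->
  (forall x, U x -> is_derive x 1 f (f x * y x)) -> (forall k, Ck_on k U y) ->
  forall k, Ck_on k U f.
Proof.
move=> oU fd yC; elim=> [|k IH].
  split=> // x Ux; apply/differentiable_continuous/derivable1_diffP.
  by have [] := fd _ Ux.
apply: Ck_onS1 => // [x /fd[]//|].
by apply: eq_Ck_on (Ck_onM oU IH (yC k)) => // x /fd[_ ->].
Qed.

(** The same bootstrap, with [g' = F o g] as smooth as [g]. *)
Lemma smooth_autonomous_ode T U g (F : R^o -> R^o) : open T -> open U ->
  (forall t, T t -> U (g t)) -> (forall t, T t -> is_derive t 1 g (F (g t))) ->
  (forall k, Ck_on k U F) -> forall k, Ck_on k T g.
Proof.
move=> oT oU TU gd FC; elim=> [|k IH].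
  split=> // x Tx; apply/differentiable_continuous/derivable1_diffP.
  by have [] := gd _ Tx.
apply: Ck_onS1 => // [x /gd[]//|].
by apply: eq_Ck_on (Ck_on_comp1 oT oU TU IH (FC k)) => // x /gd[_ ->].
Qed.

End Ck_line.

(** * One-sided derivatives computed through extensions *)

Section derive_within.
Context {R : realType} {V W : normedModType R}.

Lemma cvg_line (x v : V) : (h *: v + x) @[h --> (0 : R)] --> x.
Proof.
rewrite -[X in _ --> X]add0r -[X in _ --> X + _](scale0r v).
by apply: cvgD; [apply: cvgZr_tmp; exact: cvg_id|exact: cvg_cst].
Qed.

Lemma derive_withinE (A U : set V) (f g : V -> W) (x v : V) :
  (forall e, 0 < e -> exists h : R, [/\ h != 0, `|h| < e & A (h *: v + x)]) ->
  A x -> nbhs x U -> (forall y, A y -> U y -> f y = g y) -> derivable g x v ->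
  derive_within A f x v = 'D_v g x.
Proof.
move=> acc Ax Ux fg gd; rewrite /derive_within.
set S := [set h : R | A (h *: v + x)].
have PF : ProperFilter (within S 0^').
  apply: Build_ProperFilter_ex => P /nbhs_ballP[e /= e0 eP].
  have [h [h0 he hA]] := acc _ e0; exists h; apply: eP => //=.
  by rewrite -ball_normE /ball_ /= sub0r normrN.
apply: cvg_lim => //.
have Unear : \forall h \near (0 : R), U (h *: v + x) by exact: cvg_line.
apply: (@cvg_trans _ ((fun h : R => h^-1 *: (g (h *: v + x) - g x)) @ within S 0^')).
  apply: near_eq_cvg; rewrite near_withinE.
  near=> h => hS /=; rewrite !fg//; first exact: nbhs_singleton.
  by near: h; apply: cvg_within; exact: Unear.
by apply: cvg_trans gd; apply: cvg_app; exact: cvg_within.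
Unshelve. all: by end_near. Qed.

End derive_within.

(** * Scalar equations *)

Section blowup.
Context {R : realType}.

(** The antiderivative is the integral from [a]. Continuity at [a] makes it converge, while [f] may
    be singular at [b]; the asymmetry is exploited in [slow_decay_ode]. *)
Lemma continuous_antiderivative (f : R -> R) (a b : R) :
  (forall x, a <= x < b -> {for x, continuous f}) ->
  exists F : R -> R, forall x, a < x < b -> is_derive x 1 F (f x).
Proof.
move=> fc; exists (fun y => \int[@lebesgue_measure R]_(t in `[a, y]) f t)%R.
move=> x /andP[ax xb].
pose u := (x + b) / 2.
have xu : x < u by rewrite /u; lra.
have ub : u < b by rewrite /u; lra.
have [] := @continuous_FTC1_closed R f a x u xu _ ax _.
- apply: continuous_compact_integrable; first exact: segment_compact.
  apply: continuous_in_subspaceT => y; rewrite inE/= in_itv/= => /andP[ay yu].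
  by apply: fc; rewrite ay (le_lt_trans yu).
- by apply: fc; rewrite (ltW ax).
- by move=> fd fE; exact: DeriveDef fd (etrans (esym (derive1E _ _)) fE).
Qed.

Lemma MVT_derivable (f df : R -> R) (a b : R) : a < b ->
  (forall x, a <= x <= b -> is_derive x 1 f (df x)) ->
  exists2 c, a < c < b & f b - f a = df c * (b - a).
Proof.
move=> ab fd; have fc : {within `[a, b], continuous f}.
  apply: derivable_within_continuous => x; rewrite in_itv/= => xab.
  by have [] := fd _ xab.
have fd' x : x \in `]a, b[ -> is_derive x 1 f (df x).
  by rewrite in_itv/= => /andP[ax xb]; apply: fd; rewrite !ltW.
by have [c + E] := MVT ab fd' fc; rewrite in_itv; exists c.
Qed.

Lemma IVT_derivable (f df : R -> R) (a b v : R) : a <= b ->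
  (forall x, a <= x <= b -> is_derive x 1 f (df x)) ->
  f b <= v <= f a -> exists2 c, a <= c <= b & f c = v.
Proof.
move=> ab fd /andP[bv va]; have fc : {within `[a, b], continuous f}.
  apply: derivable_within_continuous => x; rewrite in_itv/= => xab.
  by have [] := fd _ xab.
have vI : Num.min (f a) (f b) <= v <= Num.max (f a) (f b).
  by rewrite ge_min le_max va bv orbT.
by have [c + E] := IVT ab fc vI; rewrite in_itv; exists c.
Qed.

Lemma is_derive_reflect (f : R -> R) (x d : R) :
  is_derive (- x) 1 f d -> is_derive x 1 (fun y => f (- y)) (- d).
Proof.
move=> fd; have nd : is_derive x 1 (-%R : R -> R) (-1) by exact: is_deriveNid.
have := @is_derive_compR R f -%R x d (-1) fd nd; rewrite mulrN1; exact.
Qed.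

(* The solution is the inverse of the function [u] with [u' = - 1 / F]; the
   bound [F r <= C r] makes [u] diverge at 0, so it exists for all times. *)
Lemma slow_decay_ode (F : R -> R) (d C : R) : 0 < d -> 0 < C ->
  (forall r, 0 < r < d -> {for r, continuous F}) ->
  (forall r, 0 < r < d -> 0 < F r <= C * r) ->
  exists (g : R -> R) (T : set R),
    [/\ open T, (forall t, 0 <= t -> T t), (forall t, T t -> 0 < g t < d),
        (forall t, T t -> is_derive t 1 g (- F (g t))) &
        g t @[t --> +oo] --> 0].
Proof.
move=> d0 C0 Fc FC.
(* [1 / F] is singular at 0, so the integration has to start from the other end. Reflecting [r] to
   [- r] turns that end into the left one. *)
have [U UE] : exists U : R -> R, forall x, - (d / 2) < x < 0 ->
    is_derive x 1 U ((F (- x))^-1).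
  apply: continuous_antiderivative => x /andP[dx x0].
  have xd : 0 < - x < d by lra.
  apply: (@continuousV _ _ (fun x => F (- x))).
    by rewrite gt_eqF//; have /andP[] := FC _ xd.
  apply: (@continuous_comp _ _ _ (-%R) F); first exact: opp_continuous.
  exact: Fc.
(* [r1] is the value of the solution at time 0. Being strictly inside the interval, it makes 0 an
   interior point of the time domain [T]. *)
pose a := d / 2; pose r1 := a / 2; pose u r := U (- r) - U (- r1).
have a0 : 0 < a by rewrite /a; lra.
have F0 r : 0 < r < a -> 0 < F r.
  by move=> ra; have /andP[] : 0 < F r <= C * r by apply: FC; rewrite /a in ra; lra.
have ud r : 0 < r < a -> is_derive r 1 u (- (F r)^-1).
  move=> ra; rewrite -[- _]subr0; apply: is_deriveB.
  by apply: is_derive_reflect; rewrite -[in (F r)](opprK r); apply: UE; rewrite -/a; lra.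
have udec r s : 0 < r -> r < s -> s < a -> u s < u r.
  move=> r0 rs sa; have [x xrs|c cs E] := @MVT_derivable u (fun r => - (F r)^-1) r s rs.
    by apply: ud; lra.
  rewrite -subr_lt0 E pmulr_llt0 ?subr_gt0// oppr_lt0 invr_gt0 F0//; lra.
have uinj r s : 0 < r < a -> 0 < s < a -> u r = u s -> r = s.
  move=> /andP[r0 ra] /andP[s0 sa] E; case: (ltgtP r s) => // rs.
    by have := udec _ _ r0 rs sa; rewrite E ltxx.
  by have := udec _ _ s0 rs ra; rewrite E ltxx.
pose T := [set t | exists2 r, 0 < r < a & u r = t].
pose g t := xget 0 [set r | 0 < r < a /\ u r = t].
have gP t : T t -> 0 < g t < a /\ u (g t) = t.
  by move=> [r ra E]; apply: (@xgetPex _ 0 [set r | 0 < r < a /\ u r = t]); exists r.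
have gu r : 0 < r < a -> g (u r) = r.
  move=> ra; have [ga gE] : 0 < g (u r) < a /\ u (g (u r)) = u r by apply: gP; exists r.
  exact: uinj gE.
have ivt r s t : 0 < r -> r <= s -> s < a -> u s <= t <= u r -> T t.
  move=> r0 rs sa tE.
  have [x xrs|c cs E] := @IVT_derivable u (fun r => - (F r)^-1) r s t rs _ tE.
    by apply: ud; lra.
  by exists c => //; lra.
have r10 : 0 < r1 by rewrite /r1; lra.
have r1a : r1 < a by rewrite /r1; lra.
have u1 : u r1 = 0 by rewrite /u subrr.
(* The sum [u + ln / C] has derivative [- 1 / F + 1 / (C x)], which is nonpositive because
   [F x <= C x]; so its value at [r] is at least its value at [r1]. *)
have ulog r : 0 < r -> r < r1 -> (ln r1 - ln r) / C <= u r.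
  move=> r0 rr1.
  have [x /andP[rx xr1]|c /andP[rc cr1] E] := @MVT_derivable (u + (fun x => C^-1 * ln x))
      (fun x => - (F x)^-1 + C^-1 * x^-1) r r1 rr1.
    apply: is_deriveD; first by apply: ud; lra.
    by apply: is_deriveZ; apply: is_derive1_ln; lra.
  suff : (u + (fun x => C^-1 * ln x)) r1 - (u + (fun x => C^-1 * ln x)) r <= 0.
    by rewrite !fctE u1; lra.
  rewrite E pmulr_lle0 ?subr_gt0// -invfM addrC subr_le0.
  have cd : 0 < c < d by rewrite /r1 /a in cr1; lra.
  by have /andP[Fc0 FcC] := FC _ cd; rewrite lef_pV2// posrE mulr_gt0//; lra.
have T0 t : 0 <= t -> T t.
  (* At this [r] the logarithmic lower bound for [u] equals [t], so [t] lies between [u r1 = 0] and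
     [u r]. *)
  move=> t0; pose r := r1 * expR (- (C * t)).
  have [->|tn0] := eqVneq t 0; first by exists r1; rewrite ?r10.
  have r0 : 0 < r by rewrite mulr_gt0// expR_gt0.
  have rr1 : r < r1.
    by rewrite gtr_pMr// expR_lt1 oppr_lt0 mulr_gt0// lt_neqAle eq_sym tn0.
  apply: (@ivt r r1) => //; first exact: ltW.
  rewrite u1 t0/= (le_trans _ (ulog _ r0 rr1))// /r lnM ?posrE ?expR_gt0// expRK.
  by rewrite opprD addNKr opprK mulrAC divff ?mul1r// gt_eqF.
exists g, T; split.
- rewrite openE => t [r /andP[r0 ra] <-].
  (* The values of [u] at points on both sides of [r] enclose [u r], and the intermediate value
     theorem puts everything between them into [T]. *)
  have h1 : u ((r + a) / 2) < u r by apply: udec; lra.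
  have h2 : u r < u (r / 2) by apply: udec; lra.
  have : \forall y \near u r, y \in `]u ((r + a) / 2), u (r / 2)[.
    by apply: near_in_itvoo; rewrite in_itv/= h1.
  apply: filterS => y; rewrite in_itv/= => /andP[y1 y2].
  by apply: (@ivt (r / 2) ((r + a) / 2)); rewrite ?(ltW y1) ?(ltW y2)//; lra.
- exact: T0.
- by move=> t /gP[/andP[-> gta] _]; rewrite (lt_trans gta)// /a; lra.
- move=> t Tt; have [gta ut] := gP _ Tt.
  have near_a : \forall y \near g t, 0 < y < a.
    have : \forall y \near g t, y \in `]0, a[ by apply: near_in_itvoo; rewrite in_itv.
    by apply: filterS => y; rewrite in_itv.
  rewrite -{1}ut -[- F _]invrK invrN; apply: is_derive_inverse.
  + by apply: filterS near_a => y; exact: gu.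
  + apply: filterS near_a => y ya; apply/differentiable_continuous/derivable1_diffP.
    by have [] := ud _ ya.
  + exact: ud.
  + by rewrite oppr_eq0 invr_eq0 gt_eqF// F0.
- apply/cvgrPdist_lt => e e0; near=> t.
  have t0 : 0 <= t by near: t; apply: nbhs_pinfty_ge; exact: num_real.
  have [/andP[gt0 gta] ut] := gP _ (T0 _ t0).
  rewrite sub0r normrN gtr0_norm//; case: (ltP (g t) e) => // eg.
  have : u e < t by near: t; apply: nbhs_pinfty_gt; exact: num_real.
  rewrite -{1}ut; have [->|ne] := eqVneq e (g t); first by rewrite ltxx.
  by move=> /(lt_trans (udec _ _ e0 _ gta)); rewrite lt_neqAle ne eg ltxx; apply.
Unshelve. all: by end_near. Qed.

End blowup.

Section damping.
Context {R : realType}.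

Lemma is_derive_expR_comp (g : R -> R) (x dg : R) :
  is_derive x 1 g dg -> is_derive x 1 (fun y => expR (g y)) (expR (g x) * dg).
Proof.
by move=> gd; apply: (@is_derive_compR R (@expR R) g x (expR (g x)) dg) gd.
Qed.

Lemma is_derive_ln_comp (g : R -> R) (x dg : R) : 0 < g x ->
  is_derive x 1 g dg -> is_derive x 1 (fun y => ln (g y)) ((g x)^-1 * dg).
Proof.
move=> gx0 gd; apply: (@is_derive_compR R (@ln R) g x (g x)^-1 dg) gd.
exact: is_derive1_ln.
Qed.

Lemma open_oo (a b : R) : open ([set r : R^o | a < r < b] : set R^o).
Proof.
rewrite openE => r /= rab; have : \forall y \near r, y \in `]a, b[.
  by apply: near_in_itvoo; rewrite in_itv.
by apply: filterS => y; rewrite in_itv.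
Qed.

(** Here [r] is the distance to the boundary parameter, [rho] the defining function along the path,
    [z] the smooth part of the one-form on the velocity, and [theta] the parameter of [d]. If
    [g' = - F(g)], then [tau = theta o g] has [tau' = - (F theta')(g)], and the last clause becomes
    the equation for [tau'']. The linear bound on [F] is the hypothesis of [slow_decay_ode]. *)
Lemma damping_function (rho z theta : R^o -> R^o) (alpha d : R) :
  0 < alpha -> alpha <= 2 -> 0 < d ->
  (forall k, Ck_on k [set r : R^o | - d < r < d] rho) ->
  (forall k, Ck_on k [set r : R^o | - d < r < d] z) ->
  (forall k, Ck_on k [set r : R^o | - d < r < d] theta) ->
  rho 0 = 0 -> 0 < 'D_1 rho 0 -> 'D_1 theta 0 != 0 ->
  exists (F : R^o -> R^o) (d' C : R),
    [/\ 0 < d' <= d, 0 < C, (forall k, Ck_on k [set r : R^o | 0 < r < d'] F),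
        (forall r, 0 < r < d' -> [/\ 0 < F r <= C * r, 0 < rho r &
          0 < 'D_1 theta 0 * 'D_1 theta r]) &
        forall r : R^o, 0 < r < d' -> is_derive r (1 : R^o)
          (fun r => F r * 'D_1 theta r : R^o)
          (2 * (z r + (alpha * rho r)^-1 * 'D_1 rho r) * (F r * 'D_1 theta r))].
Proof.
move=> al0 al2 d0 rhoC zC thC rho0 drho0 dth0.
have I0 : - d < 0 < d by lra.
have Dcont (f : R^o -> R^o) : (forall k, Ck_on k [set r : R^o | - d < r < d] f) ->
    {for (0 : R), continuous (fun r => 'D_1 f r)}.
  by move=> fC; exact: Ck_on_continuous (Ck_on_derive (1 : R^o) (fC 1%N)) I0.
have isd (f : R^o -> R^o) r : (forall k, Ck_on k [set r : R^o | - d < r < d] f) ->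
    - d < r < d -> is_derive r 1 f ('D_1 f r).
  by move=> fC rd; apply: DeriveDef => //; exact: Ck_on_derivable (fC 1%N) rd.
(* Starting at [- (d / 2)] keeps the base point inside the domain of [z] and puts 0 in the interior,
   so that [H] is continuous, hence bounded, near 0. *)
have [H HE] : exists H : R -> R, forall x, - (d / 2) < x < d -> is_derive x 1 H (z x).
  apply: continuous_antiderivative => x xd.
  by apply: Ck_on_continuous (zC 0%N) _ => /=; lra.
pose K := 2 * 'D_1 rho 0; have K0 : 0 < K by rewrite /K; lra.
pose t0 := 'D_1 theta 0.
(* These three bounds produce the three factors of the final constant: [K], [expR (2 * H 0 + 2)] and
   2. *)
have [e /= e0 eP] : \forall r \near (0 : R), [/\ 0 < 'D_1 rho r < K,
    H r < H 0 + 1 & t0 ^+ 2 / 2 < t0 * 'D_1 theta r].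
  have c1 : 'D_1 rho r @[r --> (0 : R)] --> 'D_1 rho 0 := Dcont _ rhoC.
  have c2 : H r @[r --> (0 : R)] --> H 0.
    apply/differentiable_continuous/derivable1_diffP.
    by have [] := HE 0 _ => //; lra.
  have c3 : t0 * 'D_1 theta r @[r --> (0 : R)] --> t0 * t0.
    by apply: cvgMl_tmp; exact: Dcont thC.
  near=> r; split.
  - apply/andP; split; near: r.
      exact: cvgr_gt drho0.
    by apply: (cvgr_lt _ c1); rewrite /K; lra.
  - by near: r; apply: (cvgr_lt _ c2); lra.
  - by near: r; apply: (cvgr_gt _ c3); have : 0 < t0 ^+ 2 by [rewrite exprn_even_gt0|]; lra.
(* The bound [K^-1] forces [rho r <= K * r <= 1], so that [ln (rho r)] is nonpositive. *)
pose d' := Num.min (Num.min e (d / 2)) K^-1.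
have d'0 : 0 < d' by rewrite !lt_min e0 invr_gt0 K0 divr_gt0.
have d'd r : 0 < r < d' -> [/\ - d < r < d, - (d / 2) < r < d & r * K <= 1].
  move=> /andP[r0]; rewrite !lt_min => /andP[/andP[re rd] rK].
  by split; [lra|lra|rewrite -ler_pdivlMr// mul1r ltW].
have near r : 0 <= r < d' -> [/\ 0 < 'D_1 rho r < K,
    H r < H 0 + 1 & t0 ^+ 2 / 2 < t0 * 'D_1 theta r].
  move=> /andP[r0]; rewrite !lt_min => /andP[/andP[re rd] rK].
  by apply: eP; rewrite /= sub0r normrN ger0_norm.
have rhoP r : 0 < r < d' -> 0 < rho r <= K * r.
  move=> /andP[r0 rd'].
  have [x xr|c /andP[c0 cr]] := @MVT_derivable R rho (fun r => 'D_1 rho r) 0 r r0.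
    by apply: isd => //; have [] := d'd r _; lra.
  rewrite rho0 !subr0 => ->.
  have [/andP[h1 h2] _ _] : [/\ 0 < 'D_1 rho c < K,
    H c < H 0 + 1 & t0 ^+ 2 / 2 < t0 * 'D_1 theta c] by apply: near; lra.
  by rewrite mulr_gt0//= ler_wpM2r// ltW.
pose y r := 2 * (z r + (alpha * rho r)^-1 * 'D_1 rho r).
(* [Psi] is [rho ^ (2 / alpha) * exp (2 H)], the integrating factor with [Psi' = y Psi]. *)
pose Psi r := expR (2 / alpha * ln (rho r) + 2 * H r).
have PsiD r : 0 < r < d' -> is_derive r 1 Psi (Psi r * y r).
  move=> rd; have /andP[rr0 _] := rhoP _ rd; have [rd1 rd2 _] := d'd _ rd.
  apply: (@is_derive_expR_comp (fun r => 2 / alpha * ln (rho r) + 2 * H r)).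
  have -> : y r = 2 / alpha * ((rho r)^-1 * 'D_1 rho r) + 2 * z r.
    by rewrite /y; field; rewrite !gt_eqF.
  apply: is_deriveD; apply: is_deriveZ; last exact: HE.
  by apply: is_derive_ln_comp => //; exact: isd.
have thP r : 0 < r < d' -> 0 < t0 * 'D_1 theta r /\ 'D_1 theta r != 0.
  move=> rd; have [_ _ h] : [/\ 0 < 'D_1 rho r < K,
    H r < H 0 + 1 & t0 ^+ 2 / 2 < t0 * 'D_1 theta r] by apply: near; lra.
  have h0 : 0 < t0 ^+ 2 by rewrite exprn_even_gt0.
  have h1 : 0 < t0 * 'D_1 theta r by lra.
  by split=> //; apply: contraTneq h1 => ->; rewrite mulr0 ltxx.
have oI := @open_oo 0 d'.
have sub r : (0 < r < d') -> - d < r < d by move=> /d'd[].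
have subC k (f : R^o -> R^o) : Ck_on k [set r : R^o | - d < r < d] f ->
    Ck_on k [set r : R^o | 0 < r < d'] f.
  by apply: Ck_on_subset => r; apply: sub.
have yC k : Ck_on k [set r : R^o | 0 < r < d'] (y : R^o -> R^o).
  apply: Ck_onM => //; first exact: Ck_on_cst.
  apply: Ck_onD => //; first exact: subC.
  apply: Ck_onM => //; last by apply: subC; exact: Ck_on_derive.
  apply: Ck_onV => // [r /rhoP/andP[r0 _]|]; first by rewrite mulf_neq0// gt_eqF.
  by apply: Ck_onM => //; [exact: Ck_on_cst|exact: subC].
have PsiC := smooth_linear_ode oI PsiD yC.
(* [F theta' = t0 Psi] solves the linear equation, and the factor [t0 = theta'(0)] makes [F]
   positive whichever way [theta] runs. *)
exists (fun r => t0 * Psi r * ('D_1 theta r)^-1), d', (2 * K * expR (2 * H 0 + 2)).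
split.
- by rewrite d'0 !ge_min; apply/orP; left; apply/orP; right; lra.
- by rewrite !mulr_gt0// expR_gt0.
- move=> k; apply: Ck_onM => //.
    by apply: Ck_onM => //; exact: Ck_on_cst.
  apply: Ck_onV => // [r /thP[]//|].
  by apply: subC; exact: Ck_on_derive.
- move=> r rd; have [h0 hn0] := thP _ rd; have /andP[rr0 rrK] := rhoP _ rd.
  split=> //.
  have -> : t0 * Psi r * ('D_1 theta r)^-1 = t0 ^+ 2 / (t0 * 'D_1 theta r) * Psi r.
    by field; rewrite hn0.
  have Psi0 : 0 < Psi r by exact: expR_gt0.
  have t20 : 0 < t0 ^+ 2 by rewrite exprn_even_gt0.
  have [_ h1 h2] : [/\ 0 < 'D_1 rho r < K,
    H r < H 0 + 1 & t0 ^+ 2 / 2 < t0 * 'D_1 theta r] by apply: near; lra.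
  rewrite mulr_gt0 ?divr_gt0//=.
  have q2 : t0 ^+ 2 / (t0 * 'D_1 theta r) <= 2 by rewrite ler_pdivrMr//; lra.
  apply: (le_trans (ler_wpM2r (ltW Psi0) q2)).
  rewrite -!mulrA ler_pM2l//.
  (* This is where [alpha <= 2] enters: since [rho r <= 1] and [2 / alpha >= 1], the power
     [rho ^ (2 / alpha)] is at most [rho]. *)
  apply: (@le_trans _ _ (rho r * expR (2 * H 0 + 2))); last first.
    have := ler_wpM2r (expR_ge0 (2 * H 0 + 2)) rrK.
    by move=> /le_trans; apply; rewrite /K -!mulrA [r * expR _]mulrC.
  have -> : rho r = expR (ln (rho r)) by rewrite lnK.
  rewrite -expRD ler_expR; apply: lerD; last by lra.
  have lnr : ln (rho r) <= 0.
    by apply: ln_le0; apply: (le_trans rrK); rewrite mulrC; have [] := d'd _ rd.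
  rewrite -subr_ge0.
  have -> : ln (rho r) - 2 / alpha * ln (rho r) = (2 / alpha - 1) * (- ln (rho r)) by ring.
  by rewrite mulr_ge0 ?oppr_ge0// subr_ge0 ler_pdivlMr// mul1r.
- move=> r rd; rewrite -/(y r); have [h0 hn0] := thP _ rd.
  have -> : y r * (t0 * Psi r * ('D_1 theta r)^-1 * 'D_1 theta r) = t0 * (Psi r * y r).
    by rewrite divfK// [LHS]mulrC -[LHS]mulrA.
  apply: (@near_eq_is_derive _ _ _ (fun r => t0 * Psi r : R^o)).
    have := open_nbhs_nbhs (conj oI rd).
    by apply: filterS => s sd; have [_ sn0] := thP _ sd; rewrite divfK.
  by apply: is_deriveZ; exact: PsiD.
Unshelve. all: by end_near. Qed.

End damping.

(** * Charts and curves *)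

Lemma within_continuous_near {T S : topologicalType} (A : set T) (f : T -> S) x
    (V : set S) : {within A, continuous f} -> A x -> nbhs (f x) V ->
  \forall y \near x, A y -> V (f y).
Proof.
by move=> /subspace_continuousP/(_ x) fc /fc fx /fx.
Qed.

Section coordinates.
Context {R : realType} {n : nat} (M : manifold_with_boundary R n).
Implicit Types (a b : chart M) (p : M) (V : set M).

Lemma coord_half_space a p : dom a p -> @half_space R n (coord a p).
Proof.
move=> ap; have [Q _ E] := coord_image_open a.
suff: (Q `&` @half_space R n) (coord a p) by case.
by rewrite -E; exists p.
Qed.

Lemma inner_coord_gt0 a p : dom a p -> inner M p -> 0 < coord a p 0 0.
Proof.
move=> ap ip; have := coord_half_space ap; rewrite /half_space/= le_eqVlt.
by case/predU1P => // E; case: ip; exists a.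
Qed.

Lemma coord_image_nbhs a V p : open V -> V p -> dom a p ->
  exists N : set 'rV[R]_n.+1,
    [/\ open N, N (coord a p) & N `&` @half_space R n `<=` coord_image a V].
Proof.
move=> oV Vp ap; have [Q oQ E] := coord_image_open a.
have pap : (coord a @` dom a) (coord a p) by exists p.
have pV : nbhs (point a (coord a p)) V by rewrite coordK//; exact: open_nbhs_nbhs.
have nV := within_continuous_near (@point_continuous _ _ M a) pap pV.
have Qp : Q (coord a p) by move: pap; rewrite E => -[].
exists (Q `&` interior [set x | (coord a @` dom a) x -> V (point a x)]); split.
- by apply: openI => //; exact: open_interior.
- by split.
- move=> x [[Qx /interior_subset /= Vx] hx].
  have [q aq qx] : (coord a @` dom a) x by rewrite E.
  by exists q => //; split => //; rewrite -(coordK aq) qx; apply: Vx; exists q.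
Qed.

(** At an inner point the 0-th coordinate is positive, so the half-space condition holds on a whole
    neighborhood. Transition maps are thus smooth in the ordinary sense near inner points. *)
Lemma coord_image_inner_open a V p : open V -> V p -> dom a p -> inner M p ->
  exists N : set 'rV[R]_n.+1, [/\ open N, N (coord a p) & N `<=` coord_image a V].
Proof.
move=> oV Vp ap ip; have [N [oN Np NV]] := coord_image_nbhs oV Vp ap.
exists (N `&` [set x | 0 < x 0 0]); split.
- apply: openI => //.
  apply: (@open_comp _ _ (fun x : 'rV[R]_n.+1 => x 0 0 : R^o) [set t : R^o | 0 < t]).
    by move=> x _; exact: matrix_normedtype.coord_continuous.
  exact: open_gt.
- by split => //; exact: inner_coord_gt0.
- by move=> x [Nx x0]; apply: NV; split => //; exact: ltW.
Qed.

Lemma derive_within_nbhs {V W : normedModType R} (A : set V) (f : V -> W) (x v : V) :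
  nbhs x A -> derivable f x v -> derive_within A f x v = 'D_v f x.
Proof.
move=> xA fd; apply: (@derive_withinE _ _ _ A A) => //; last exact: nbhs_singleton.
move=> e e0.
have /nbhs_ballP[d /= d0 dA] : \forall h \near (0 : R), A (h *: v + x) by exact: cvg_line.
have m0 : 0 < Num.min (d / 2) (e / 2) by rewrite lt_min !divr_gt0.
exists (Num.min (d / 2) (e / 2)); split; first by rewrite gt_eqF.
  by rewrite gtr0_norm// gt_min; apply/orP; right; lra.
apply: dA; rewrite /ball/= sub0r normrN gtr0_norm// gt_min.
by apply/orP; left; lra.
Qed.

(** Small steps from [s] towards another point of [J] stay in [J]. This provides the accumulation
    hypothesis of [derive_withinE], endpoints included. *)
Lemma interval_direction (J : set R) s : nondegenerate_interval J -> J s ->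
  forall e, 0 < e -> exists h : R, [/\ h != 0, `|h| < e & J (h *: (1 : R^o) + s)].
Proof.
move=> [iJ [x [y [Jx Jy xy]]]] Js e e0.
have [w Jw ws] : exists2 w, J w & w != s.
  by have [<-|?] := eqVneq x s; [exists y => //; rewrite gt_eqF|exists x].
have [ws0|sw0] : w < s \/ s < w by apply/orP; rewrite -neq_lt.
- pose h := Num.min (e / 2) (s - w).
  have h0 : 0 < h by rewrite lt_min divr_gt0// subr_gt0.
  have hw : h <= s - w by rewrite ge_min lexx orbT.
  exists (- h); split; first by rewrite oppr_eq0 gt_eqF.
    by rewrite normrN gtr0_norm// gt_min; apply/orP; left; lra.
  by apply: (iJ w s) => //; rewrite [_ *: _]mulr1; apply/andP; split; lra.
- pose h := Num.min (e / 2) (w - s).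
  have h0 : 0 < h by rewrite lt_min divr_gt0// subr_gt0.
  have hw : h <= w - s by rewrite ge_min lexx orbT.
  exists h; split; first by rewrite gt_eqF.
    by rewrite gtr0_norm// gt_min; apply/orP; left; lra.
  by apply: (iJ s w) => //; rewrite [_ *: _]mulr1; apply/andP; split; lra.
Qed.

Lemma derive_comp_mx m k (U : set 'rV[R]_m.+1) (f : 'rV[R]_m.+1 -> 'rV[R]_k)
    (x : R^o -> 'rV[R]_m.+1) (s : R^o) :
  open U -> U (x s) -> Ck_on 1 U f -> derivable x s 1 ->
  'D_1 (f \o x) s = 'D_('D_1 x s) f (x s).
Proof.
move=> oU Ux fC xd; have fCi i : Ck_on 1 U (fun y => f y 0 i : R^o).
  by have /(Ck_on_mxP 1 f oU) := fC; apply.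
have fxd i := is_derive_comp_rV oU Ux (fCi i) xd.
have fd : derivable f (x s) ('D_1 x s) by exact: Ck_on_derivable fC Ux.
have fxm : derivable (f \o x) s 1.
  by apply/(derivable_mxP (f \o x) s 1) => i j; rewrite ord1; have [] := fxd j.
rewrite (derive_mx fxm) (derive_mx fd).
apply/matrixP => i j; rewrite !mxE ord1; have [_ ->] := fxd j.
by have [df dE] := C1_differentiable oU Ux (fCi j); rewrite [RHS]deriveE// dE.
Qed.

Lemma dtransition_velocity a b (W : set R^o) (d : R -> M) (s : R^o) :
  open W -> W s -> (forall t, W t -> (dom a `&` dom b) (d t)) -> inner M (d s) ->
  derivable (curve_in a d) s 1 ->
  'D_1 (curve_in b d) s = dtransition a b (coord a (d s)) ('D_1 (curve_in a d) s).
Proof.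
move=> oW Ws Wab ids xd; have [as_ bs] := Wab s Ws.
have [N [oN Np NV]] := coord_image_inner_open (dom_open b) bs as_ ids.
have tC k : Ck_on k N (transition a b).
  apply: smooth_on_interior oN NV => //; exact: transition_smooth.
rewrite /dtransition derive_within_nbhs; last 2 first.
- by apply: filterS NV _; exact: open_nbhs_nbhs.
- exact: Ck_on_derivable (tC 1%N) Np.
rewrite -[coord a (d s)]/(curve_in a d s) -(derive_comp_mx oN Np (tC 1%N) xd).
apply: near_eq_derive; have := open_nbhs_nbhs (conj oW Ws).
by apply: filterS => t /Wab[at_ bt]; rewrite /= /transition/= /curve_in/= coordK.
Qed.

End coordinates.

(** * The quadratic form of a connection under projective change *)

Section christoffel_forms.
Context {R : realType} {n : nat}.
Implicit Types (G : 'I_n.+1 -> 'I_n.+1 -> 'rV[R]_n.+1) (v y : 'rV[R]_n.+1).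

Lemma eq_christoffel_form G G' v w : (forall i j, G i j = G' i j) ->
  christoffel_form G v w = christoffel_form G' v w.
Proof.
by move=> E; apply: eq_bigr => i _; apply: eq_bigr => j _; rewrite E.
Qed.

Lemma sum_basis_vec v : \sum_j v 0 j *: basis_vec j = v.
Proof. by rewrite [RHS]row_sum_delta. Qed.

(** Each of the two added terms contracts to [pairing y v *: v]. The change is thus tangential,
    which is why a change of parameter can absorb it. *)
Lemma christoffel_form_proj_change G y v :
  christoffel_form (fun i j => G i j + y 0 i *: basis_vec j + y 0 j *: basis_vec i) v v =
  christoffel_form G v v + (2 * pairing y v) *: v.
Proof.
have E1 : \sum_i \sum_j (v 0 i * v 0 j) *: (y 0 i *: basis_vec j) = pairing y v *: v.
  rewrite /pairing scaler_suml; apply: eq_bigr => i _.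
  transitivity ((y 0 i * v 0 i) *: (\sum_j v 0 j *: basis_vec j)); last first.
    by rewrite sum_basis_vec.
  rewrite scaler_sumr; apply: eq_bigr => j _.
  by rewrite !scalerA; congr (_ *: _); ring.
have E2 : \sum_i \sum_j (v 0 i * v 0 j) *: (y 0 j *: basis_vec i) = pairing y v *: v.
  rewrite exchange_big -E1; apply: eq_bigr => i _; apply: eq_bigr => j _.
  by rewrite [v 0 j * _]mulrC.
rewrite /christoffel_form mulr_natl mulr2n scalerDl addrA -{1}E1 -E2 -!big_split/=.
apply: eq_bigr => i _; rewrite -!big_split/=; apply: eq_bigr => j _.
by rewrite !scalerDr.
Qed.

Lemma christoffel_formZ G (k : R) v :
  christoffel_form G (k *: v) (k *: v) = k ^+ 2 *: christoffel_form G v v.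
Proof.
rewrite /christoffel_form scaler_sumr; apply: eq_bigr => i _.
rewrite scaler_sumr; apply: eq_bigr => j _; rewrite !mxE scalerA.
by congr (_ *: _); ring.
Qed.

Lemma pairingZr y (k : R) v : pairing y (k *: v) = k * pairing y v.
Proof.
by rewrite /pairing mulr_sumr; apply: eq_bigr => i _; rewrite !mxE; ring.
Qed.

End christoffel_forms.

Section derivatives_along_curves.
Context {R : realType}.

Lemma is_derive_scale_mx m n (k : R^o -> R^o) (f : R^o -> 'M[R]_(m, n)) (s : R^o) :
  derivable k s 1 -> derivable f s 1 ->
  is_derive s 1 (fun u => k u *: f u) (k s *: 'D_1 f s + 'D_1 k s *: f s).
Proof.
move=> kd fd; have fdi i j : derivable (fun u => f u i j : R^o) s 1.
  by have /derivable_mxP := fd; apply.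
have E i j : (fun u => (k u *: f u) i j : R^o) = k * (fun u => f u i j : R^o).
  by apply/funext => u; rewrite mxE.
have kfd : derivable (fun u => k u *: f u) s 1.
  apply/(derivable_mxP (fun u => k u *: f u) s 1) => i j.
  by rewrite E; exact: derivableM kd (fdi i j).
apply: DeriveDef => //; rewrite (derive_mx kfd) (derive_mx fd).
apply/matrixP => i j; rewrite !mxE E (deriveM kd (fdi i j)); congr (_ + _).
by rewrite [LHS]mulrC.
Qed.

End derivatives_along_curves.

(** * Reparametrized geodesics *)

Section reparametrization.
Context {R : realType} {n : nat} (M : manifold_with_boundary R n).

Lemma smooth_curve_derivatives (A : set R) (a : chart M) (c : R -> M)
    (x : R^o -> 'rV[R]_n.+1) (W : set R^o) (s : R^o) :
  (forall t, A t -> forall e, 0 < e ->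
     exists h : R, [/\ h != 0, `|h| < e & A (h *: (1 : R^o) + t)]) ->
  open W -> W s -> A s -> (forall t, A t -> W t -> curve_in a c t = x t) ->
  (forall k, Ck_on k W x) ->
  velocity A a c s = 'D_1 x s /\ acceleration A a c s = 'D_1 (fun t => 'D_1 x t) s.
Proof.
move=> acc oW Ws As cx xC.
have vE t : A t -> W t -> velocity A a c t = 'D_1 x t.
  move=> At Wt; apply: (@derive_withinE _ _ _ A W) => //; first exact: acc.
    exact: open_nbhs_nbhs.
  exact: Ck_on_derivable (xC 1%N) Wt.
split; first exact: vE.
apply: (@derive_withinE _ _ _ A W) => //; first exact: acc.
  exact: open_nbhs_nbhs.
exact: Ck_on_derivable (Ck_on_derive (1 : R^o) (xC 2%N)) Ws.
Qed.

Lemma open_preimage_on {T S : topologicalType} (U : set T) (V : set S) (f : T -> S) :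
  open U -> open V -> (forall x, U x -> {for x, continuous f}) ->
  open (U `&` f @^-1` V).
Proof.
move=> oU oV fc; rewrite openE => x [Ux Vfx].
rewrite /interior; apply: filterI; first exact: open_nbhs_nbhs.
by apply: fc => //; exact: open_nbhs_nbhs.
Qed.

Lemma smooth_curve_continuous (J : set R) (d : R -> M) (I : set R^o) s :
  smooth_curve J d -> open I -> I `<=` J -> I s -> {for s, continuous d}.
Proof.
move=> [dc _] oI IJ Is V dsV.
have h := within_continuous_near dc (IJ _ Is) dsV.
have h' : \forall t \near s, I t by exact: open_nbhs_nbhs.
rewrite /= ; apply: filterS2 h h' => t hV It; exact/hV/IJ.
Qed.

Lemma smooth_curve_chart (J : set R) (d : R -> M) (I : set R^o) (a : chart M) :
  smooth_curve J d -> open I -> I `<=` J ->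
  open (I `&` d @^-1` dom a) /\ forall k, Ck_on k (I `&` d @^-1` dom a) (curve_in a d).
Proof.
move=> dS oI IJ.
have oIa : open (I `&` d @^-1` dom a).
  apply: open_preimage_on => //; first exact: dom_open.
  by move=> s; exact: smooth_curve_continuous dS oI IJ.
split=> // k; have [_ /(_ a) dsm] := dS.
apply: smooth_on_interior dsm oIa _ => t [It at_].
by split => //; exact: IJ.
Qed.

Lemma one_form_velocity (Y : covector_field M) (J : set R) (d : R -> M)
    (I : set R^o) (a b : chart M) (s : R^o) :
  one_form (inner M) Y -> smooth_curve J d -> open I -> I `<=` J -> I s ->
  dom a (d s) -> dom b (d s) -> inner M (d s) ->
  pairing (Y a (coord a (d s))) ('D_1 (curve_in a d) s) =
  pairing (Y b (coord b (d s))) ('D_1 (curve_in b d) s).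
Proof.
move=> [_ Yab] dS oI IJ Is as_ bs ids.
have [oa aC] := smooth_curve_chart a dS oI IJ.
have [ob bC] := smooth_curve_chart b dS oI IJ.
rewrite (@dtransition_velocity _ _ _ a b _ d s (openI oa ob)); last 1 first.
- exact: Ck_on_derivable (aC 1%N) _.
- exact: Yab.
- by [].
- by move=> t [[? ?] [? ?]].
- by [].
Qed.

(** Let [x] be [d] in a chart [b]. Then [(x o tau)'' = tau'' x' + tau'^2 x''], and the forms of
    [nabla] and [G] on [x'] differ by [2 Y(x') x']; the equation of [d] leaves
    [(tau'' - 2 Y(x') tau'^2) x'], which vanishes. Since [Y] is a one-form, the condition on [tau'']
    may be checked in any one chart for each [t]. The open set [T] around the half-line gives
    two-sided derivatives at time 0. *)
Lemma geodesic_reparametrization (G nabla : christoffel M) (Y : covector_field M)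
    (J : set R) (d : R -> M) (I T : set R^o) (tau : R^o -> R^o) (c : R -> M) :
  geodesic G J d -> one_form (inner M) Y ->
  eq_connection_on (inner M) G (proj_change nabla Y) ->
  open I -> I `<=` J -> open T -> (forall t : R, 0 <= t -> T t) ->
  (forall k, Ck_on k T tau) -> (forall t, T t -> I (tau t)) ->
  (forall t, T t -> inner M (d (tau t))) ->
  (forall t, T t -> exists2 a : chart M, dom a (d (tau t)) &
     'D_1 (fun u : R^o => 'D_1 tau u) t =
     2 * pairing (Y a (coord a (d (tau t)))) ('D_1 (curve_in a d) (tau t))
       * ('D_1 tau t) ^+ 2) ->
  (forall t, T t -> c t = d (tau t)) ->
  geodesic nabla [set t : R | 0 <= t] c.
Proof.
move=> [dJ dS dG] Yform GY oI IJ oT T0 tauC TI Tin ode cE.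
have itv0 : nondegenerate_interval [set t : R | 0 <= t].
  split; first by move=> x y /= x0 _ z /andP[xz _]; exact: le_trans xz.
  by exists 0, 1; split=> //=.
have tauc t : T t -> {for t, continuous tau}.
  by move=> Tt; exact: Ck_on_continuous (tauC 0%N) Tt.
(* [W] collects the times at which [d o tau] lies in the chart. There [curve_in a d o tau] is the
   smooth extension through which the one-sided derivatives of [c] are computed. *)
have chartP a : exists W : set R^o, [/\ open W /\ W `<=` T,
    (forall t, T t -> dom a (d (tau t)) -> W t),
    (forall t, W t -> curve_in a c t = curve_in a d (tau t)),
    (forall k, Ck_on k W (curve_in a d \o tau)) &
    (forall t, W t -> (I `&` d @^-1` dom a) (tau t))].
  have [oa aC] := smooth_curve_chart a dS oI IJ.
  exists (T `&` tau @^-1` (I `&` d @^-1` dom a)); split.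
  - by split; [exact: open_preimage_on|move=> t []].
  - by move=> t Tt at_; split=> //; split=> //; exact: TI.
  - by move=> t [Tt _]; rewrite /curve_in/= cE.
  - move=> k; have oW := open_preimage_on oT oa tauc.
    apply: (@Ck_on_comp_mx R k 1 n.+1 _ _ _ tau oW oa) => //; first by move=> t [].
    by apply: Ck_on_subset (tauC k) => t [].
  - by move=> t [].
split=> //.
  split.
    apply: continuous_in_subspaceT => t; rewrite inE/= => t0; have Tt := T0 _ t0.
    have ct : {for t, continuous (d \o tau)}.
      apply: continuous_comp; first exact: tauc.
      exact: smooth_curve_continuous dS oI IJ (TI _ Tt).
    apply: near_eq_continuous_at ct; have := open_nbhs_nbhs (conj oT Tt).
    by apply: filterS => u Tu; rewrite cE.
  move=> a t [/= t0 at_]; have [W [[oW WT] TW WE WC WI]] := chartP a.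
  have Tt := T0 _ t0; exists W, (curve_in a d \o tau); split=> //.
    by apply: TW => //; rewrite -cE.
  by move=> u [_ /WE].
move=> b t /= t0 bt; have Tt := T0 _ t0; rewrite cE// in bt.
have [W [[oW WT] TW WE WC WI]] := chartP b; have Wt := TW _ Tt bt.
have [-> ->] := smooth_curve_derivatives (fun u => @interval_direction R _ u itv0) oW Wt t0
  (fun u _ => WE u) WC.
have [ob bC] := smooth_curve_chart b dS oI IJ.
have Is := TI _ Tt; have Ibs : (I `&` d @^-1` dom b) (tau t) by [].
set x := curve_in b d in bC WE WC *; set s := tau t in bt Is Ibs *.
have [vE aE] := smooth_curve_derivatives (fun u => @interval_direction R _ u dJ) ob Ibs (IJ _ Is)
  (fun u _ _ => erefl (x u)) bC.
have := dG b s (IJ _ Is) bt; rewrite vE aE => eqG.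
have [a ads odea] := ode _ Tt.
rewrite -(one_form_velocity Yform dS oI IJ Is bt ads (Tin _ Tt)) in odea.
have xd : derivable x s 1 by exact: Ck_on_derivable (bC 1%N) Ibs.
have comp1 u : W u -> 'D_1 (x \o tau) u = 'D_1 tau u *: 'D_1 x (tau u).
  move=> Wu; have Tu := WT _ Wu.
  have td : derivable tau u 1 by exact: Ck_on_derivable (tauC 1%N) Tu.
  have xtd : derivable x (tau u) 1 by exact: Ck_on_derivable (bC 1%N) (WI _ Wu).
  by have [] := is_derive_comp_line td xtd.
have comp2 : 'D_1 (fun u => 'D_1 (x \o tau) u) t =
    'D_1 (fun u => 'D_1 tau u) t *: 'D_1 x s +
    ('D_1 tau t) ^+ 2 *: 'D_1 (fun u => 'D_1 x u) s.
  rewrite (@near_eq_derive _ _ _ _ (fun u => 'D_1 tau u *: ((fun v => 'D_1 x v) \o tau) u)).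
    have td : derivable tau t 1 by exact: Ck_on_derivable (tauC 1%N) Tt.
    have td2 : derivable (fun u => 'D_1 tau u) t 1.
      exact: Ck_on_derivable (Ck_on_derive (1 : R^o) (tauC 2%N)) Tt.
    have xd2 : derivable (fun v => 'D_1 x v) (tau t) 1.
      exact: Ck_on_derivable (Ck_on_derive (1 : R^o) (bC 2%N)) Ibs.
    have [cd cdE] := is_derive_comp_line td xd2.
    have [_ ->] := is_derive_scale_mx td2 cd.
    by rewrite cdE scalerA addrC.
  by have := open_nbhs_nbhs (conj oW Wt); apply: filterS => u /comp1.
rewrite comp2 (comp1 t Wt) (WE t Wt) christoffel_formZ -/s.
have GE i j : G b (x s) i j = proj_change nabla Y b (x s) i j.
  exact: (GY b (d s) (conj bt (Tin _ Tt)) i j).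
rewrite (eq_christoffel_form _ _ GE) in eqG.
rewrite christoffel_form_proj_change in eqG.
have -> : christoffel_form (nabla b (x s)) ('D_1 x s) ('D_1 x s) =
    - 'D_1 (fun u => 'D_1 x u) s - (2 * pairing (Y b (x s)) ('D_1 x s)) *: 'D_1 x s.
  by apply/eqP; rewrite -subr_eq0 -opprD opprK addrCA eqG.
rewrite odea scalerBr scalerN scalerA addrA addrK.
by rewrite [_ ^+ 2 * _]mulrC subrr.
Qed.

End reparametrization.

(** * Behavior at the boundary *)

Section boundary_data.
Context {R : realType} {n : nat} (M : manifold_with_boundary R n).

Lemma half_space_direction (N : set 'rV[R]_n.+1) (x : 'rV[R]_n.+1) i :
  open N -> (N `&` @half_space R n) x -> forall e, 0 < e ->
  exists h : R, [/\ h != 0, `|h| < e &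
    (N `&` @half_space R n) (h *: basis_vec i + x)].
Proof.
move=> oN [Nx hx] e e0.
have /nbhs_ballP[d /= d0 dA] : \forall h \near (0 : R), N (h *: basis_vec i + x).
  by apply: cvg_line; exact: open_nbhs_nbhs.
have m0 : 0 < Num.min (d / 2) (e / 2) by rewrite lt_min !divr_gt0.
exists (Num.min (d / 2) (e / 2)); split; first by rewrite gt_eqF.
  by rewrite gtr0_norm// gt_min; apply/orP; right; lra.
split; last first.
  by rewrite /half_space/= !mxE eqxx/= addr_ge0// mulr_ge0 ?ler0n// ltW.
apply: dA; rewrite /ball/= sub0r normrN gtr0_norm// gt_min.
by apply/orP; left; lra.
Qed.

(** In the chart, points near [x0] with 0-th coordinate 0 are boundary points, where [rho] vanishes.
    So the tangential partial derivatives are 0, and a nonzero differential forces the normal one to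
    be nonzero. *)
Lemma defining_function_chart (U : set M) (rho : M -> R) (a : chart M) (x0 : M) :
  local_defining_function U rho -> U x0 -> dom a x0 -> coord a x0 0 0 = 0 ->
  exists (N : set 'rV[R]_n.+1) (g : 'rV[R]_n.+1 -> R^o),
    [/\ open N /\ N (coord a x0), (forall k, Ck_on k N g),
        N `&` @half_space R n `<=` coord_image a U,
        (forall x, (N `&` @half_space R n) x -> g x = rho (point a x) /\
           forall i, differential U rho a x 0 i = 'D_(basis_vec i) g x) &
        'D_(basis_vec 0) g (coord a x0) != 0 /\
        forall i, i != 0 -> 'D_(basis_vec i) g (coord a x0) = 0].
Proof.
move=> [oU rhoS rho_ge0 rho0 drho] Ux0 ax0 p00; set p0 := coord a x0.
have [N1 [g [oN1 N1p gC gE]]] := rhoS a p0 (ex_intro2 _ _ x0 (conj ax0 Ux0) erefl).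
have [N2 [oN2 N2p N2U]] := coord_image_nbhs oU Ux0 ax0.
pose N := N1 `&` N2; have oN : open N by exact: openI.
have Np : N p0 by [].
have NU : N `&` @half_space R n `<=` coord_image a U.
  by move=> x [[_ N2x] hx]; exact: N2U.
have NE x : (N `&` @half_space R n) x -> g x = rho (point a x).
  by move=> Nx; rewrite -gE//; split; [exact: NU|case: Nx => -[]].
have gCN k : Ck_on k N g by apply: Ck_on_subset (gC k) => x [].
have dE x : (N `&` @half_space R n) x ->
    forall i, differential U rho a x 0 i = 'D_(basis_vec i) g x.
  move=> Nx i; rewrite mxE.
  apply: (@derive_withinE _ _ _ _ N) => //.
  - move=> e e0; have [h [h0 he hN]] := half_space_direction i oN Nx e0.
    by exists h; split=> //; exact: NU.
  - exact: NU.
  - by apply: open_nbhs_nbhs; split=> //; case: Nx.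
  - by move=> y Uy [N1y _]; exact: gE.
  - by apply: Ck_on_derivable (gCN 1%N) _; case: Nx.
have hp0 : half_space p0 by exact: coord_half_space.
have d0 i : i != 0 -> 'D_(basis_vec i) g p0 = 0.
  move=> i0.
  have gd : derivable g (0 *: basis_vec i + p0) (basis_vec i).
    by rewrite scale0r add0r; exact: Ck_on_derivable (gCN 1%N) Np.
  have [_] := is_derive_line gd; rewrite scale0r add0r => <-.
  rewrite (@near_eq_derive _ _ _ _ (cst 0)) ?derive_cst//.
  have : \forall h \near (0 : R), N (h *: basis_vec i + p0).
    by apply: cvg_line; exact: open_nbhs_nbhs.
  apply: filterS => h Nh.
  have x00 : (h *: basis_vec i + p0) 0 0 = 0.
    by rewrite !mxE eqxx/= eq_sym (negbTE i0) mulr0 add0r.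
  have Nhh : (N `&` @half_space R n) (h *: basis_vec i + p0).
    by split => //; rewrite /half_space/= x00.
  rewrite NE//; have [q [aq Uq] qE] := NU _ Nhh.
  rewrite -qE coordK//; apply/rho0 => //.
  by exists a => //; rewrite qE.
exists N, g; split=> //.
- by move=> x Nx; split; [exact: NE|exact: dE].
split=> //; apply/negP => /eqP g0.
have /eqP := drho a x0 (conj (conj ax0 Ux0) (ex_intro2 _ _ a ax0 p00)); apply.
apply/rowP => i; rewrite dE// mxE.
by have [->|/d0] := eqVneq i 0.
Qed.

(** If [G] and [G'] are both projective changes of one connection, [zeta i] is the [i]-th component
    of the difference of the two one-forms. It extends smoothly across the boundary because both
    connections are smooth up to it. *)
Lemma christoffel_difference_chart (U : set M) (G G' : christoffel M) (a : chart M)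
    (x0 : M) : affine_connection setT G -> affine_connection U G' -> U x0 ->
  dom a x0 ->
  exists (N : set 'rV[R]_n.+1) (zeta : 'I_n.+1 -> 'rV[R]_n.+1 -> R^o),
    [/\ open N, N (coord a x0), (forall i k, Ck_on k N (zeta i)) &
        forall x, N x -> coord_image a U x -> forall i,
          zeta i x = 2^-1 * (G a x i i 0 i - G' a x i i 0 i)].
Proof.
move=> [GS _ _] [G'S _ _] Ux0 ax0; set p0 := coord a x0.
have pU : coord_image a U p0 by exists x0.
have pT : coord_image a setT p0 by exists x0.
have loc (i : 'I_n.+1) : exists Nf : set 'rV[R]_n.+1 * ('rV[R]_n.+1 -> R^o),
    [/\ open Nf.1, Nf.1 p0, (forall k, Ck_on k Nf.1 Nf.2) &
        forall x, Nf.1 x -> coord_image a U x ->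
          Nf.2 x = 2^-1 * (G a x i i 0 i - G' a x i i 0 i)].
  have [N1 [g1 [oN1 N1p g1C g1E]]] := GS a i i p0 pT.
  have [N2 [g2 [oN2 N2p g2C g2E]]] := G'S a i i p0 pU.
  have oN := openI oN1 oN2.
  exists (N1 `&` N2, fun x => 2^-1 * (g1 x 0 i + -1 * g2 x 0 i)); split=> //=.
    move=> k; apply: Ck_onM => //; first exact: Ck_on_cst.
    apply: Ck_onD => //.
      have /(Ck_on_mxP k g1 oN1) h := g1C k.
      by apply: Ck_on_subset (h 0 i) => x [].
    apply: Ck_onM => //; first exact: Ck_on_cst.
    have /(Ck_on_mxP k g2 oN2) h := g2C k.
    by apply: Ck_on_subset (h 0 i) => x [].
  move=> x [N1x N2x] xU; rewrite mulN1r g1E ?g2E//; split=> //.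
  by case: xU => q [aq _] <-; exists q.
have [Nf NfP] := fin_all_exists loc.
exists (interior [set x | forall i, (Nf i).1 x]), (fun i => (Nf i).2); split.
- exact: open_interior.
- suff H : \forall x \near p0, forall i, (Nf i).1 x by exact: H.
  apply: (@filter_forall _ _ (fun (i : 'I_n.+1) x => (Nf i).1 x) (nbhs p0)) => i.
  by have [oN Np _ _] := NfP i; exact: open_nbhs_nbhs.
- move=> i k; have [_ _ NC _] := NfP i; apply: Ck_on_subset (NC k) => x.
  by move=> /interior_subset/(_ i).
- move=> x /interior_subset Nx xU i; have [_ _ _ NE] := NfP i.
  by apply: NE => //; exact: Nx.
Qed.

(** Two extensions are composed: [theta] continues the change of parameter beyond [J], and [xi]
    continues the coordinates of [d] beyond [J']. *)
Lemma curve_extension_chart (J J' : set R) (d gamma : R -> M) (th : R -> R) (s0 : R)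
    (a : chart M) (U : set M) :
  smooth_curve J' d -> reparametrizes_part J' d J gamma th -> J s0 ->
  dom a (gamma s0) -> open U -> U (gamma s0) ->
  exists (W : set R^o) (X : R^o -> 'rV[R]_n.+1) (theta : R^o -> R^o),
    [/\ open W /\ W s0, (forall k, Ck_on k W X), (forall k, Ck_on k W theta) &
        forall s, J s -> W s -> [/\ th s = theta s, dom a (gamma s), U (gamma s) &
          coord a (gamma s) = X s]].
Proof.
move=> [dc dS] [thS thP] Js0 as0 oU Us0.
have [J's0 _ g0] := thP _ Js0; rewrite g0 in as0 Us0.
have [W1 [theta [oW1 W1s thetaC thE]]] := thS _ Js0.
have [V1 [xi [oV1 V1s xiC xiE]]] := dS a (th s0) (conj J's0 as0).
have nV : nbhs (d (th s0)) (dom a `&` U).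
  by apply: open_nbhs_nbhs; split => //; apply: openI => //; exact: dom_open.
have nd := within_continuous_near dc J's0 nV.
pose V := V1 `&` interior [set y | J' y -> (dom a `&` U) (d y)].
have oV : open V by apply: openI => //; exact: open_interior.
have Vs0 : V (theta s0) by rewrite -thE.
have thc s : W1 s -> {for s, continuous theta}.
  by move=> W1s'; exact: Ck_on_continuous (thetaC 0%N) W1s'.
have oW := open_preimage_on oW1 oV thc.
have thW k : Ck_on k (W1 `&` theta @^-1` V) theta.
  by apply: Ck_on_subset (thetaC k) => s [].
exists (W1 `&` theta @^-1` V), (xi \o theta), theta; split=> //.
  move=> k; have xiV : Ck_on k V xi by apply: Ck_on_subset (xiC k) => s [].
  by apply: (Ck_on_comp_mx oW oV _ (thW k) xiV) => s [].
move=> s Js [W1s' [V1s' /interior_subset /= V2s]].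
have [J's _ gs] := thP _ Js; have E := thE s (conj Js W1s').
have [ads Uds] : (dom a `&` U) (d (th s)) by rewrite E; apply: V2s; rewrite -E.
rewrite gs; split=> //.
have := xiE (th s); rewrite /curve_in /= E; apply.
by rewrite -E; split => //; rewrite E.
Qed.

End boundary_data.

Section boundary_expansion.
Context {R : realType} {n : nat} (M : manifold_with_boundary R n).

(** This reduces the geometry to functions of one variable. [Y] is singular at the boundary, but on
    the velocity it splits into a smooth [z] and the logarithmic derivative of [r], the defining
    function along the path, divided by [alpha]. *)
Lemma boundary_expansion (nabla G Ghat : christoffel M) (Y : covector_field M)
    (alpha : R) (U : set M) (rho : M -> R) (J J' : set R) (d gamma : R -> M)
    (th : R -> R) (s0 : R) (a : chart M) :
  affine_connection setT G -> affine_connection U Ghat ->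
  eq_connection_on (inner M) G (proj_change nabla Y) ->
  local_defining_function U rho ->
  eq_connection_on (U `&` inner M) Ghat
    (proj_change nabla (fun a y =>
       (alpha * rho (point a y))^-1 *: differential U rho a y)) ->
  smooth_curve J' d -> nondegenerate_interval J ->
  reparametrizes_part J' d J gamma th -> J s0 ->
  U (gamma s0) -> dom a (gamma s0) -> coord a (gamma s0) 0 0 = 0 ->
  velocity J a gamma s0 0 0 != 0 ->
  exists (W : set R^o) (X : R^o -> 'rV[R]_n.+1) (theta r z : R^o -> R^o),
    [/\ open W /\ W s0,
        forall k, [/\ Ck_on k W X, Ck_on k W theta, Ck_on k W r & Ck_on k W z],
        r s0 = 0 /\ 'D_1 r s0 != 0, 'D_1 theta s0 != 0 &
        forall s, J s -> W s ->
          [/\ th s = theta s, dom a (gamma s), coord a (gamma s) = X s, 0 <= r s &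
              0 < r s -> inner M (gamma s) /\
                pairing (Y a (X s)) ('D_1 X s) =
                z s + (alpha * r s)^-1 * 'D_1 r s]].
Proof.
move=> Gaff Ghaff GY rhoD GhE dS dJ thR Js0 Us0 as0 p00 vel.
have oU : open U by case: rhoD.
have [N1 [g [[oN1 N1p] gC _ gE [dg0 dgi]]]] := defining_function_chart rhoD Us0 as0 p00.
have [N2 [zeta [oN2 N2p zC zE]]] := christoffel_difference_chart Gaff Ghaff Us0 as0.
have [W1 [X [theta [[oW1 W1s] XC thC XE]]]] := curve_extension_chart dS thR Js0 as0 oU Us0.
have oN := openI oN1 oN2.
have Xc s : W1 s -> {for s, continuous X}.
  by move=> W1s'; exact: Ck_on_continuous (XC 0%N) W1s'.
have oW := open_preimage_on oW1 oN Xc.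
set W := W1 `&` X @^-1` (N1 `&` N2) in oW.
have X0 : coord a (gamma s0) = X s0 by have [] := XE _ Js0 W1s.
have Ws0 : W s0 by split=> //; rewrite /preimage/= -X0.
have XCW k : Ck_on k W X by apply: Ck_on_subset (XC k) => s [].
have thCW k : Ck_on k W theta by apply: Ck_on_subset (thC k) => s [].
have gCN k : Ck_on k (N1 `&` N2) g by apply: Ck_on_subset (gC k) => s [].
have rC k : Ck_on k W (g \o X).
  by apply: (Ck_on_comp_rV oW oN _ (XCW k) (gCN k)) => s [].
pose z s : R^o := \sum_i zeta i (X s) * ('D_1 X s) 0 i.
have zCW k : Ck_on k W z.
  apply: Ck_on_sum => // i; apply: Ck_onM => //.
    have ziC : Ck_on k (N1 `&` N2) (zeta i) by apply: Ck_on_subset (zC i k) => s [].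
    by apply: (Ck_on_comp_rV oW oN _ (XCW k) ziC) => s [].
  by have /(Ck_on_mxP k _ oW) := Ck_on_derive (1 : R^o) (XCW k.+1); apply.
have Xd s : W s -> derivable X s 1 by move=> Ws; exact: Ck_on_derivable (XCW 1%N) Ws.
have rd s : W s -> 'D_1 (g \o X) s = \sum_i ('D_1 X s) 0 i * 'D_(basis_vec i) g (X s).
  move=> Ws; have N1X : N1 (X s) by case: Ws => _ [].
  by have [] := is_derive_comp_rV oN1 N1X (gC 1%N) (Xd _ Ws).
have rE s : J s -> W s -> [/\ U (gamma s), dom a (gamma s),
    (N1 `&` @half_space R n) (X s), coord_image a U (X s) & (g \o X) s = rho (gamma s)].
  move=> Js Ws; have [W1s' [N1X N2X]] := Ws; have [_ ads Uds E] := XE _ Js W1s'.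
  have NX : (N1 `&` @half_space R n) (X s).
    by split => //; rewrite -E; exact: coord_half_space.
  split=> //; first by exists (gamma s).
  by have [gX _] := gE _ NX; rewrite /= gX -E coordK.
exists W, X, theta, (g \o X), z; split=> //.
- split.
    have [_ _ _ _ ->] := rE _ Js0 Ws0.
    by have [_ _ _ rho0 _] := rhoD; apply/rho0 => //; exists a.
  have [vE _] := smooth_curve_derivatives (fun u => @interval_direction R _ u dJ)
    oW Ws0 Js0 (fun s Js Ws => let: And4 _ _ _ E := XE s Js Ws.1 in E) XCW.
  (* At the boundary only the normal term of the chain rule survives. It is the normal velocity
     times the normal derivative, both nonzero. *)
  rewrite rd// -X0 (bigD1 0)//= big1 ?addr0; last by move=> i /dgi ->; rewrite mulr0.
  by rewrite mulf_neq0// -vE.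
- have [thS thP] := thR; have [_ + _] := thP _ Js0.
  rewrite (@derive_withinE _ _ _ J W1 _ theta)//.
  + exact: interval_direction.
  + exact: open_nbhs_nbhs.
  + by move=> s Js W1s'; have [] := XE _ Js W1s'.
  + exact: Ck_on_derivable (thC 1%N) W1s.
move=> s Js Ws; have [W1s' [N1X N2X]] := Ws.
have [thE ads Uds E] := XE _ Js W1s'.
have [_ _ NX XU rsE] := rE _ Js Ws.
split=> //.
  by rewrite rsE; have [_ _ + _ _] := rhoD; apply.
move=> r0; have is_ : inner M (gamma s).
  have [_ _ _ rho0 _] := rhoD => /(rho0 _ Uds) rs0.
  by rewrite rsE rs0 ltxx in r0.
split=> //; rewrite rd// /z mulr_sumr -big_split/=; apply: eq_bigr => i _.
have [gX dE] := gE _ NX.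
(* Subtracting the two diagonal formulas cancels [nabla] and expresses [Y] through [zeta] and the
   differential of the defining function. *)
have GYi : G a (X s) i i 0 i = nabla a (X s) i i 0 i + 2 * Y a (X s) 0 i.
  by rewrite -E (GY a (gamma s) (conj ads is_) i i) /proj_change !mxE !eqxx/=; ring.
have GhYi : Ghat a (X s) i i 0 i = nabla a (X s) i i 0 i +
    2 * ((alpha * g (X s))^-1 * 'D_(basis_vec i) g (X s)).
  have := GhE a (gamma s) (conj ads (conj Uds is_)) i i; rewrite E => ->.
  rewrite /proj_change -gX.
  set u := (_ *: differential _ _ _ _).
  have -> : u 0 i = (alpha * g (X s))^-1 * 'D_(basis_vec i) g (X s).
    by rewrite [LHS]mxE dE.
  by rewrite !mxE !eqxx/=; ring.
have -> : Y a (X s) 0 i = zeta i (X s) +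
    (alpha * g (X s))^-1 * 'D_(basis_vec i) g (X s).
  rewrite zE// GYi GhYi; set v := (alpha * g (X s))^-1 * _.
  by move: (nabla a (X s) i i 0 i) (Y a (X s) 0 i) v => p q v; lra.
by rewrite /=; ring.
Qed.

End boundary_expansion.

(** * From the boundary parameter to infinite time *)

Section affine_parameter.
Context {R : realType} (s0 eps : R).

Definition affine_param (r : R^o) : R^o := s0 + eps * r.

Lemma is_derive_affine_param (r : R^o) : is_derive r 1 affine_param (eps : R^o).
Proof.
have := is_deriveD (is_derive_cst (s0 : R^o) r (1 : R^o))
  (is_deriveZ eps (is_derive_id r (1 : R^o))).
by rewrite add0r [eps *: _]mulr1.
Qed.

Lemma Ck_on_affine_param k (U : set R^o) : open U -> Ck_on k U affine_param.
Proof.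
move=> oU; apply: Ck_onW; apply: Ck_onS1 => //.
apply: eq_Ck_on (Ck_on_cst k (eps : R^o) oU) => // r _.
by have [_ ->] := is_derive_affine_param r.
Qed.

Lemma derive_comp_affine_param {W : normedModType R} (f : R^o -> W) (r : R^o) :
  derivable f (affine_param r) 1 ->
  'D_1 (f \o affine_param) r = eps *: 'D_1 f (affine_param r).
Proof.
move=> fd; have [ad aE] := is_derive_affine_param r.
by have [_ ->] := is_derive_comp_line ad fd; rewrite aE.
Qed.

End affine_parameter.

(** A negative derivative at 0 would, by the mean value theorem, make [f] negative just to the right
    of 0. *)
Lemma derive_gt0_at_min {R : realType} (f : R^o -> R^o) (d : R) :
  0 < d -> (forall k, Ck_on k [set r : R^o | - d < r < d] f) -> f 0 = 0 ->
  (forall r, 0 < r < d -> 0 <= f r) -> 'D_1 f 0 != 0 -> 0 < 'D_1 f 0.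
Proof.
move=> d0 fC f0 fge df0; rewrite lt_neqAle eq_sym df0 leNgt; apply/negP => dfneg.
have I0 : - d < 0 < d by lra.
have Dc : 'D_1 f r @[r --> (0 : R)] --> 'D_1 f 0.
  exact: Ck_on_continuous (Ck_on_derive (1 : R^o) (fC 1%N)) I0.
have [e /= e0 eP] : \forall r \near (0 : R), 'D_1 f r < 0 by exact: (cvgr_lt _ Dc).
pose r := Num.min e d / 2.
have m0 : 0 < Num.min e d by rewrite lt_min e0.
have rm : 0 < r /\ r < Num.min e d by rewrite /r; split; lra.
have [r0 rr] := rm; move: rr; rewrite lt_min => /andP[re rd].
have fd x : 0 <= x <= r -> is_derive x 1 f ('D_1 f x).
  move=> xr; have Ix : - d < x < d by lra.
  exact: DeriveDef (Ck_on_derivable (fC 1%N) Ix) erefl.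
have [c /andP[c0 cr]] := MVT_derivable r0 fd; rewrite f0 !subr0 => E.
have fr : 0 <= f r by apply: fge; rewrite r0.
have : 'D_1 f c < 0 by apply: eP; rewrite /= sub0r normrN gtr0_norm// (lt_trans cr).
by move=> dc; move: fr; rewrite E pmulr_lge0// leNgt dc.
Qed.

(* [th] is strictly monotone, so an interior parameter is mapped strictly
   between two points of the interval. *)
Lemma regular_image_interior {R : realType} (J : set R) (th : R^o -> R^o) (a b r : R) :
  is_interval J -> (forall x, a < x < b -> J (th x)) ->
  (forall x, a < x < b -> derivable th x 1) ->
  (exists k, forall x, a < x < b -> 0 < k * 'D_1 th x) -> a < r < b ->
  (interior (J : set R^o)) (th r).
Proof.
move=> iJ Jth thd [k kP] rab.
pose r1 := (a + r) / 2; pose r2 := (r + b) / 2.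
have [h1 h2 h3 h4] : [/\ a < r1, r1 < r, r < r2 & r2 < b].
  by rewrite /r1 /r2; split; lra.
have isd x : a < x < b -> is_derive x 1 th ('D_1 th x).
  by move=> xab; apply: DeriveDef => //; exact: thd.
have incr x y : a < x -> x < y -> y < b -> 0 < k * (th y - th x).
  move=> ax xy yb; have fd z : x <= z <= y -> is_derive z 1 th ('D_1 th z).
    by move=> zxy; apply: isd; lra.
  have [c cxy ->] := MVT_derivable xy fd; rewrite mulrA mulr_gt0 ?subr_gt0//.
  by apply: kP; lra.
have J1 : J (th r1) by apply: Jth; lra.
have J2 : J (th r2) by apply: Jth; lra.
have k1 : 0 < k * (th r - th r1) by apply: incr => //; lra.
have k2 : 0 < k * (th r2 - th r) by apply: incr => //; lra.
have main x y : J x -> J y -> x < th r < y -> (interior (J : set R^o)) (th r).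
  move=> Jx Jy xy; have : \forall v \near th r, v \in `]x, y[.
    by apply: near_in_itvoo; rewrite in_itv.
  apply: filterS => v; rewrite in_itv/= => /andP[xv vy].
  by apply: (iJ x y) => //; rewrite !ltW.
have [k0|k0|k0] := ltgtP k 0.
- by apply: (main _ _ J2 J1); move: k1 k2; rewrite !nmulr_rgt0//; lra.
- by apply: (main _ _ J1 J2); move: k1 k2; rewrite !pmulr_rgt0//; lra.
- by rewrite k0 mul0r ltxx in k1.
Qed.

Lemma interval_side {R : realType} (J : set R) (s0 : R) :
  nondegenerate_interval J -> J s0 ->
  exists eps L : R, [/\ eps ^+ 2 = 1, 0 < L & forall r, 0 <= r <= L -> J (s0 + eps * r)].
Proof.
move=> [iJ [x [y [Jx Jy xy]]]] Js.
have [w Jw ws] : exists2 w, J w & w != s0.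
  by have [<-|?] := eqVneq x s0; [exists y => //; rewrite gt_eqF|exists x].
have [ws0|sw0] : w < s0 \/ s0 < w by apply/orP; rewrite -neq_lt.
- exists (-1), (s0 - w); split; first by rewrite sqrrN expr1n.
    by rewrite subr_gt0.
  by move=> r rL; apply: (iJ w s0) => //; apply/andP; split; lra.
- exists 1, (w - s0); split; first by rewrite expr1n.
    by rewrite subr_gt0.
  by move=> r rL; apply: (iJ s0 w) => //; apply/andP; split; lra.
Qed.

Theorem proposition2p4 (R : realType) (n : nat)
    (M : manifold_with_boundary R n)
    (nabla : christoffel M) (alpha : R) (P : set (christoffel M))
    (J : set R) (gamma : R -> M) (s0 : R) (x0 : M)
    (nabla_conn : affine_connection (inner M) nabla)
    (alpha_gt0 : 0 < alpha) (alpha_le2 : alpha <= 2)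
    (nabla_compact : projectively_compact alpha nabla)
    (P_proj : projective_structure P)
    (P_ext : extends_projective_class nabla P)
    (gamma_path : geodesic_path P J gamma)
    (gamma_bdry : reaches_bdry_transversally J gamma s0 x0) :
  exists (c : R -> M) (sigma : R -> R),
    [/\ geodesic nabla [set t : R | 0 <= t] c,
        reparametrizes_part J gamma [set t : R | 0 <= t] c sigma,
        sigma t @[t --> +oo] --> s0,
        (forall t : R, 0 <= t -> inner M (c t)) &
        c t @[t --> +oo] --> x0].
Proof.
have [dJ [G [J' [d [th [PG dG thR]]]]]] := gamma_path.
have [G0 _ PE] := P_proj.
have Gaff : affine_connection setT G by move: PG; rewrite PE => -[].
have [Y Yform GY] := P_ext _ PG.
have [Js0 gs0 [a [ax0 p00 vel]]] := gamma_bdry.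
have bx0 : bdry M x0 by exists a.
have [_ /(_ _ bx0)[U [rho [Ghat [Ux0 rhoD Ghaff GhE]]]]] := nabla_compact.
have [dJ' dS _] := dG.
rewrite -gs0 in Ux0 ax0 p00.
have [W [X [theta [rs [zs [[oW Ws0] C [rs0 drs0] dth0 WE]]]]]] :=
  boundary_expansion Gaff Ghaff GY rhoD GhE dS dJ thR Js0 Ux0 ax0 p00 vel.
(* The sign [eps] points from [s0] into [J], so [r = 0] is the boundary parameter and small [r > 0]
   runs along the path. *)
have [eps [L [eps2 L0 LJ]]] := interval_side dJ Js0.
have eps0 : eps != 0 by apply: contra_eq_neq eps2 => ->; rewrite expr0n/= eq_sym oner_neq0.
have epsn : `|eps| = 1.
  by apply/eqP; rewrite -(@eqrXn2 _ 2)// -normrX eps2 normr1 expr1n.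
pose A := @affine_param R s0 eps.
have [e0 /= e00 eW] : \forall s \near s0, W s by exact: open_nbhs_nbhs.
pose del := Num.min e0 L.
have del0 : 0 < del by rewrite lt_min e00.
pose D := [set r : R^o | - del < r < del].
have oD : open D by exact: open_oo.
have DW r : D r -> W (A r).
  move=> /andP[r1 r2]; apply: eW; rewrite /= /A /affine_param opprD addNKr normrN normrM epsn mul1r.
  have : `|r| < del by rewrite ltr_norml r1.
  by rewrite lt_min => /andP[].
have AC k : Ck_on k D A by exact: Ck_on_affine_param.
have CA (f : R^o -> R^o) : (forall k, Ck_on k W f) -> forall k, Ck_on k D (f \o A).
  by move=> fC k; apply: (Ck_on_comp1 oD oW DW (AC k) (fC k)).
have XC k : Ck_on k W X by have [] := C k.
have thC k : Ck_on k W theta by have [] := C k.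
have rsC k : Ck_on k W rs by have [] := C k.
have zsC k : Ck_on k W zs by have [] := C k.
have A0 : A 0 = s0 by rewrite /A /affine_param mulr0 addr0.
have dA (V : normedModType R) (f : R^o -> V) r : (forall k, Ck_on k W f) -> D r ->
    'D_1 (f \o A) r = eps *: 'D_1 f (A r).
  move=> fC Dr; apply: derive_comp_affine_param.
  by apply: Ck_on_derivable (fC 1%N) _; exact: DW.
have D0 : D 0 by rewrite /D/=; lra.
have JA r : 0 <= r < del -> J (A r).
  by move=> /andP[r0]; rewrite lt_min => /andP[_ rL]; apply: LJ; rewrite r0 ltW.
have DR r : 0 <= r < del -> D r by rewrite /D/=; lra.
pose rhoT := rs \o A; pose thT := theta \o A.
(* Passing from [s] to [r] multiplies the velocity, and hence its pairing with [Y], by [eps]. For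
   the singular part this factor is already contained in the derivative of [rhoT]. *)
pose zT := (fun r => eps * (zs \o A) r) : R^o -> R^o.
have zTC k : Ck_on k D zT by apply: Ck_onM => //; [exact: Ck_on_cst|exact: CA].
have rhoT0 : rhoT 0 = 0 by rewrite /rhoT /= A0.
have drhoT0 : 0 < 'D_1 rhoT 0.
  apply: (derive_gt0_at_min del0 (CA _ rsC) rhoT0) => [r /andP[r0 rd]|].
    have Dr : 0 <= r < del by rewrite (ltW r0).
    by have [] := WE _ (JA _ Dr) (DW _ (DR _ Dr)).
  by rewrite dA// A0 scaler_eq0 negb_or eps0.
have dthT0 : 'D_1 thT 0 != 0 by rewrite dA// A0 scaler_eq0 negb_or eps0.
have [F [d' [C' [/andP[d'0 d'del] C'0 FC FP FD]]]] :=
  damping_function alpha_gt0 alpha_le2 del0 (CA _ rsC) zTC (CA _ thC) rhoT0 drhoT0 dthT0.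
have Fcont r : 0 < r < d' -> {for r, continuous F}.
  by move=> rd; exact: Ck_on_continuous (FC 0%N) rd.
have Fbd r : 0 < r < d' -> 0 < F r <= C' * r by move=> /FP[].
have [g [T [oT T0 TD gD g0]]] := slow_decay_ode d'0 C'0 Fcont Fbd.
have sub r : 0 < r < d' -> 0 <= r < del by move=> /andP[r0 rd]; rewrite ltW//= (lt_le_trans rd).
have oI' := @open_oo R 0 d'.
have gC : forall k, Ck_on k T (g : R^o -> R^o).
  apply: (@smooth_autonomous_ode R T _ g (fun r => - F r : R^o) oT oI' TD gD) => k.
  have h := Ck_onM oI' (Ck_on_cst k (-1 : R^o) oI') (FC k).
  by apply: eq_Ck_on h => // r _; rewrite mulN1r.
have thTd r : D r -> derivable thT r 1.
  by move=> Dr; exact: Ck_on_derivable (CA _ thC 1%N) Dr.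
(* [sigma] is the new parameter inside [J] and [tau] the same one inside [J']:
   [c = gamma o sigma = d o tau]. *)
pose sigma t := A (g t); pose tau := thT \o g.
have tauC k : Ck_on k T tau.
  have h : Ck_on k [set r : R^o | 0 < r < d'] thT.
    by apply: Ck_on_subset (CA _ thC k) => r /sub/DR.
  exact: Ck_on_comp1 oT oI' TD (gC k) h.
have [_ thP] := thR.
have thE r : 0 < r < d' -> [/\ J' (thT r), gamma (A r) = d (thT r),
    dom a (d (thT r)), coord a (d (thT r)) = X (A r) & inner M (d (thT r))].
  move=> rd; have rdel := sub _ rd; have JAr := JA _ rdel.
  have [E ad cE _ inn] := WE _ JAr (DW _ (DR _ rdel)).
  have [J'r _ gE] := thP _ JAr; rewrite E in J'r gE.
  have [_ rr0 _] := FP _ rd; have [ii _] := inn rr0.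
  by rewrite -gE.
pose I := interior (J' : set R^o).
(* The equation of [d] is used with two-sided derivatives, so [tau] has to stay in the interior of
   [J']. *)
have thI r : 0 < r < d' -> I (thT r).
  apply: regular_image_interior; first by case: dJ'.
  - by move=> x /thE[].
  - by move=> x /sub/DR/thTd.
  - by exists ('D_1 thT 0) => x /FP[].
pose c := gamma \o sigma.
have cE t : T t -> c t = d (tau t) by move=> /TD/thE[].
have gd t : T t -> derivable (g : R^o -> R^o) t 1 by move=> /gD[].
have dtau t : T t -> 'D_1 tau t = - (F (g t) * 'D_1 thT (g t)).
  move=> Tt; have [_ ->] := is_derive_comp_line (gd _ Tt) (thTd _ (DR _ (sub _ (TD _ Tt)))).
  by have [_ ->] := gD _ Tt; rewrite [_ *: _]mulNr.
have oI : open I by exact: open_interior.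
have IJ : I `<=` J' by exact: interior_subset.
have ode t : T t -> exists2 a : chart M, dom a (d (tau t)) &
     'D_1 (fun u : R^o => 'D_1 tau u) t =
     2 * pairing (Y a (coord a (d (tau t)))) ('D_1 (curve_in a d) (tau t))
       * ('D_1 tau t) ^+ 2.
  move=> Tt; have gt := TD _ Tt; have Dg := DR _ (sub _ gt).
  have [J't _ adt cEt int] := thE _ gt; exists a => //.
  have [oa aC] := smooth_curve_chart a dS oI IJ.
  (* For small [r > 0] the extension [X o A] coincides with [d o thT] in the chart, so its
     derivative is a multiple of the velocity of [d], to which [Y] applies. *)
  have XE : 'D_1 (X \o A) (g t) = 'D_1 thT (g t) *: 'D_1 (curve_in a d) (tau t).
    have xd : derivable (curve_in a d) (thT (g t)) 1.
      by apply: Ck_on_derivable (aC 1%N) _; split; [exact: thI|].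
    have [_ <-] := is_derive_comp_line (thTd _ Dg) xd.
    apply: near_eq_derive; have := open_nbhs_nbhs (conj oI' gt).
    by apply: filterS => r /thE[].
  have [_ _ _ _ /(_ _)[]] := WE _ (JA _ (sub _ gt)) (DW _ Dg).
    by have [] := FP _ gt.
  move=> _ pE.
  have yE : zT (g t) + (alpha * rhoT (g t))^-1 * 'D_1 rhoT (g t) =
      'D_1 thT (g t) * pairing (Y a (X (A (g t)))) ('D_1 (curve_in a d) (tau t)).
    rewrite -pairingZr -XE (dA _ _ _ XC Dg) pairingZr pE (dA _ _ _ rsC Dg).
    by rewrite mulrDr mulrCA.
  have -> : 'D_1 (fun u : R^o => 'D_1 tau u) t =
      'D_1 ((fun r : R^o => - (F r * 'D_1 thT r) : R^o) \o g) t.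
    apply: near_eq_derive; have := open_nbhs_nbhs (conj oT Tt).
    by apply: filterS => u /dtau.
  have [PD PDE] := is_deriveN (FD _ gt).
  have [_ ->] := is_derive_comp_line (gd _ Tt) PD.
  rewrite PDE; have [_ ->] := gD _ Tt; rewrite dtau// yE cEt.
  by rewrite [_ *: _]mulrNN sqrrN; ring.
have inn t : T t -> inner M (d (tau t)) by move=> /TD/thE[].
have dsig t : T t -> is_derive (t : R^o) 1 (sigma : R^o -> R^o) (eps * - F (g t)).
  move=> Tt; have [ad aE] := @is_derive_affine_param R s0 eps (g t).
  have := is_derive_comp_line (gd _ Tt) ad; rewrite aE.
  by have [_ ->] := gD _ Tt; rewrite [_ *: _]mulrC.
have itv0 : nondegenerate_interval [set t : R | 0 <= t].
  split; first by move=> x y /= x0' _ z /andP[xz _]; exact: le_trans xz.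
  by exists 0, 1; split=> //=.
exists c, sigma; split.
- apply: (geodesic_reparametrization dG Yform GY oI IJ oT T0 tauC _ inn ode cE).
  by move=> t /TD/thI.
- split.
    move=> t t0; exists T, (sigma : R^o -> R^o); split=> //; first exact: T0.
    by move=> k; exact: Ck_on_comp1 oT oD (fun t Tt => DR _ (sub _ (TD _ Tt))) (gC k) (AC k).
  move=> t t0; have Tt := T0 _ t0; split=> //.
    exact/JA/sub/TD.
  have [sd sE] := dsig _ Tt.
  rewrite (@derive_withinE _ _ _ _ T _ sigma)//.
  + by rewrite sE mulf_neq0// oppr_eq0 gt_eqF//; have /andP[] := Fbd _ (TD _ Tt).
  + exact: interval_direction.
  + exact: open_nbhs_nbhs.
- rewrite -[X in _ --> X]addr0 -[X in _ --> _ + X](mulr0 eps).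
  by apply: cvgD; [exact: cvg_cst|apply: cvgMl_tmp].
- by move=> t t0; have Tt := T0 _ t0; rewrite cE//; exact: inn.
- move=> V; rewrite -gs0 => Vx0.
  (* Convergence is obtained from continuity of [d] within [J'] at [th s0]: the extension [thT] is
     continuous at 0, so [tau] tends to [thT 0 = th s0] while staying in [J']. *)
  have [J's0 _ gE] := thP _ Js0; rewrite gE in Vx0.
  have [dc _] := dS; have nd := within_continuous_near dc J's0 Vx0.
  have thT0 : th s0 = thT 0 by have [] := WE _ Js0 Ws0; rewrite /thT /= A0.
  have tau0 : tau t @[t --> +oo] --> thT 0.
    apply: (@cvg_comp _ _ _ g thT _ (nbhs (0 : R))) => //.
    exact: Ck_on_continuous (CA _ thC 0%N) D0.
  rewrite thT0 in nd; have h : \forall t \near +oo, J' (tau t) -> V (d (tau t)) := tau0 _ nd.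
  have t0 : \forall t \near +oo, (0 : R) <= t.
    by apply: nbhs_pinfty_ge; exact: num_real.
  suff : \forall t \near +oo, V (c t) by [].
  apply: filter_app h; apply: filterS t0 => t t0 h; have Tt := T0 _ t0; rewrite cE//.
  by apply: h; have [] := thE _ (TD _ Tt).
Qed.
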